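(* There exist absolute constants $c_1,c_2,c_3>0$ such that for every $n$, every isotropic convex body $K\subset\mathbb{R}^n$, every $p\in(0,1]$ and every $\theta\in\mathbb{S}^{n-1}$, $$c_3\cdot c_1^{\frac1p}\cdot L_K^{-1}<\rho_{F_pK}(\theta)<c_3\cdot c_2^{\frac1p}\cdot L_K^{-1}.$$
   Context: A convex body is a compact convex set with non-empty interior. A convex body $K\subset\mathbb{R}^n$ is isotropic if its center of mass is at the origin, $\mathrm{Vol}_n(K)=1$, and there is a constant $L_K>0$ with $\int_K\langle x,\theta\rangle^2dx=L_K^2$ for all $\theta\in\mathbb{S}^{n-1}$. For $p>0$ the Fourier $p$th mean body $F_pK$ is the star-shaped set with radial function $$\rho_{F_pK}(\theta)=\left(\frac{p}{\mathrm{Vol}_n(K)}\int_0^\infty|\widehat{\chi_K}(r\theta)|^2r^{p-1}dr\right)^{1/p},\quad\theta\in\mathbb{S}^{n-1},$$ where $\chi_K$ is the indicator function of $K$ and $\hat f(y)=\int_{\mathbb{R}^n}e^{-i\langle x,y\rangle}f(x)dx$. *)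

(* Defs.v *)
From HB Require Import structures.
From mathcomp Require Import all_boot all_order all_algebra.
From mathcomp Require Import complex.
From mathcomp Require Import all_classical all_reals all_analysis.

Set Implicit Arguments.
Unset Strict Implicit.
Unset Printing Implicit Defensive.

Import Order.TTheory GRing.Theory Num.Theory.
Import numFieldNormedType.Exports.

Local Open Scope classical_set_scope.
Local Open Scope ring_scope.

(* Row vectors carry the sigma-algebra generated by the coordinates, as tuples
   do in measurable_structure.v; for [T := R] these are the Borel sets. *)
Definition measure_rV_display : measure_display -> measure_display.
Proof. exact. Qed.

Section measurable_rV.
Context {d} {T : measurableType d} (n : nat).

Let coors (i : 'I_n) (x : 'rV[T]_n) : T := x ord0 i.

Let rV_set0 : g_sigma_preimage coors set0.
Proof. exact: sigma_algebra0. Qed.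

Let rV_setC A : g_sigma_preimage coors A -> g_sigma_preimage coors (~` A).
Proof. exact: sigma_algebraC. Qed.

Let rV_bigcup (F : _^nat) : (forall i, g_sigma_preimage coors (F i)) ->
  g_sigma_preimage coors (\bigcup_i (F i)).
Proof. exact: sigma_algebra_bigcup. Qed.

HB.instance Definition _ := @isMeasurable.Build (measure_rV_display d)
  'rV[T]_n (g_sigma_preimage coors) rV_set0 rV_setC rV_bigcup.

End measurable_rV.


Section lebesgue_rV.
Context {R : realType}.

Definition rV_rcons (n : nat) (x : 'rV[R]_n * measurableTypeR R) :
    'rV[R]_n.+1 :=
  \row_i oapp (x.1 ord0) x.2 (unlift ord_max i).

(* n-fold product of the Lebesgue measure on the line, appending the last
   coordinate at each step; [lebesgue_rV_box] computes it on boxes. *)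
Fixpoint lebesgue_rV (n : nat) : set 'rV[R]_n -> \bar R :=
  match n with
  | 0 => dirac (0 : 'rV[R]_0)
  | m.+1 => pushforward (@lebesgue_rV m \x lebesgue_measure)%E (@rV_rcons m)
  end.
Arguments lebesgue_rV : clear implicits.

Lemma measurable_rV_coord n (i : 'I_n) :
  measurable_fun [set: 'rV[R]_n] (fun x => x ord0 i).
Proof.
move=> _ Y mY; rewrite setTI; apply: sub_sigma_algebra => /=.
rewrite -bigcup_seq/=; exists i => /=; first by rewrite mem_index_enum.
by exists Y => //; rewrite setTI.
Qed.

Lemma measurable_fun_rVP d (T : measurableType d) n (f : T -> 'rV[R]_n) :
  (forall i, measurable_fun [set: T] (fun t => f t ord0 i)) ->
  measurable_fun [set: T] f.
Proof.
move=> mf _ Y mY; rewrite setTI.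
have : g_sigma_preimage (fun i : 'I_n => (fun x : 'rV[R]_n => x ord0 i) \o f)
    `<=` measurable.
  apply: smallest_sub; first exact: sigma_algebra_measurable.
  move=> A; rewrite -bigcup_seq => -[i _ [B mB <-]].
  exact: mf.
by apply; rewrite g_sigma_preimage_comp; exists Y => //; rewrite setTI.
Qed.

Lemma measurable_rV_rcons n : measurable_fun setT (@rV_rcons n).
Proof.
apply: measurable_fun_rVP => i.
rewrite /rV_rcons; under eq_fun do rewrite mxE.
case: (unlift ord_max i) => [j|] /=; last exact: measurable_snd.
apply: (@measurableT_comp _ _ _ _ _ _ (fun x : 'rV[R]_n => x ord0 j)) => //.
exact: measurable_rV_coord.
Qed.

Definition rV_belast n (y : 'rV[R]_n.+1) : 'rV[R]_n * measurableTypeR R :=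
  (\row_i y ord0 (lift ord_max i), y ord0 ord_max).

Lemma rV_rconsK n : cancel (@rV_rcons n) (@rV_belast n).
Proof.
move=> [x t]; congr pair; last by rewrite mxE unlift_none.
by apply/rowP => i; rewrite !mxE liftK.
Qed.

Lemma measurable_rV_belast n : measurable_fun setT (@rV_belast n).
Proof.
apply/measurable_fun_prod; first last.
  exact: measurable_rV_coord.
apply: measurable_fun_rVP => i /=; under eq_fun do rewrite mxE.
exact: measurable_rV_coord.
Qed.


Section step.
Variables (n : nat) (mu : {sigma_finite_measure set 'rV[R]_n -> \bar R}).

Let step := pushforward (mu \x lebesgue_measure)%E (@rV_rcons n).

Let step0 : step set0 = 0%E.
Proof. by rewrite /step /pushforward preimage_set0 measure0. Qed.

Let step_ge0 A : (0 <= step A)%E.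
Proof. by rewrite /step /pushforward; exact: measure_ge0. Qed.

Let step_sigma_additive : semi_sigma_additive step.
Proof.
exact: (@measure_semi_sigma_additive _ _ _
  (measure_function_pushforward__canonical__measure_function_Measure
    (mu \x lebesgue_measure)%E (@measurable_rV_rcons n))).
Qed.

HB.instance Definition _ := isMeasure.Build _ _ _ step
  step0 step_ge0 step_sigma_additive.

Let step_sigma_finite : sigma_finite setT step.
Proof.
have /sigma_finiteP[F [TF ndF Foo]] := sigma_finiteT mu.
have /sigma_finiteP[G [TG ndG Goo]] := sigma_finiteT (@lebesgue_measure R).
exists (fun k => @rV_belast n @^-1` (F k `*` G k)).
  rewrite -preimage_bigcup; apply/seteqP; split=> // y _ /=.
  have [k _ Fk] : (\bigcup_k F k) (rV_belast y).1 by rewrite -TF.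
  have [l _ Gl] : (\bigcup_k G k) (rV_belast y).2 by rewrite -TG.
  exists (maxn k l) => //; split => /=.
  - by move: Fk; exact/subsetPset/ndF/leq_maxl.
  - by move: Gl; exact/subsetPset/ndG/leq_maxr.
move=> k; have [mF Fk] := Foo k; have [mG Gk] := Goo k; split.
  rewrite -[X in measurable X]setTI; apply: measurable_rV_belast => //.
  exact: measurableX.
rewrite /step /pushforward -comp_preimage.
rewrite (_ : _ \o _ = id); last first.
  by apply/funext => x /=; rewrite rV_rconsK.
by rewrite preimage_id product_measure1E// lte_mul_pinfty// ge0_fin_numE.
Qed.

HB.instance Definition _ := Measure_isSigmaFinite.Build _ _ _ step
  step_sigma_finite.

Definition lebesgue_rVS : {sigma_finite_measure set 'rV[R]_n.+1 -> \bar R} :=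
  step.

End step.

Let lebesgue_rVP n : { mu : {sigma_finite_measure set 'rV[R]_n -> \bar R} |
  lebesgue_rV n = mu :> (set _ -> \bar R) }.
Proof.
elim: n => [|n [mu lebE]] /=.
  by exists [the {sigma_finite_measure set 'rV[R]_0 -> \bar R} of
    dirac (0 : 'rV[R]_0)].
by rewrite {}lebE; exists (lebesgue_rVS mu).
Qed.

Section instances.
Variable n : nat.

Let lebesgue_rV0 : lebesgue_rV n set0 = 0%E.
Proof. by case: (lebesgue_rVP n) => mu ->; rewrite measure0. Qed.

Let lebesgue_rV_ge0 A : (0 <= lebesgue_rV n A)%E.
Proof. by case: (lebesgue_rVP n) => mu ->; exact: measure_ge0. Qed.

Let lebesgue_rV_sigma_additive : semi_sigma_additive (lebesgue_rV n).
Proof.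
by case: (lebesgue_rVP n) => mu ->; exact: measure_semi_sigma_additive.
Qed.

HB.instance Definition _ := isMeasure.Build _ _ _ (lebesgue_rV n)
  lebesgue_rV0 lebesgue_rV_ge0 lebesgue_rV_sigma_additive.

Let lebesgue_rV_sigma_finite : sigma_finite setT (lebesgue_rV n).
Proof. by case: (lebesgue_rVP n) => mu ->; exact: sigma_finiteT. Qed.

HB.instance Definition _ := Measure_isSigmaFinite.Build _ _ _
  (lebesgue_rV n) lebesgue_rV_sigma_finite.

End instances.

Lemma lebesgue_rV_box n (A : 'I_n -> set R) :
  (forall i, measurable (A i)) ->
  lebesgue_rV n [set x | forall i, A i (x ord0 i)] =
  (\prod_(i < n) lebesgue_measure (A i : set (measurableTypeR R)))%E.
Proof.
elim: n A => [|n IHn] A mA /=.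
  by rewrite big_ord0 diracE mem_set// => -[].
rewrite big_ord_recr /= -IHn; last by move=> i; exact: mA.
have mB : measurable
    [set x : 'rV[R]_n | forall i, A (widen_ord (leqnSn n) i) (x ord0 i)].
  rewrite (_ : mkset _ = \bigcap_(i in [set: 'I_n])
      ((fun x : 'rV[R]_n => x ord0 i) @^-1` A (widen_ord (leqnSn n) i))).
    apply: fin_bigcap_measurable => // i _.
    by rewrite -[X in measurable X]setTI; exact: measurable_rV_coord.
  by apply/seteqP; split => [x Ax i _|x Ax i]; exact: Ax.
rewrite /pushforward -product_measure1E//; last exact: (mA ord_max).
congr product_measure1; apply/seteqP; split => -[x t] /=.
  move=> Axt; split=> [i|].
    have := Axt (lift ord_max i); rewrite mxE liftK /=.
    by rewrite (_ : lift _ _ = widen_ord (leqnSn n) i)//; exact/val_inj/lift_max.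
  by have := Axt ord_max; rewrite mxE unlift_none.
move=> [Ax At] i; rewrite mxE; case: unliftP => [j ->|->] //=.
by rewrite (_ : lift _ _ = widen_ord (leqnSn n) j)//; exact/val_inj/lift_max.
Qed.

End lebesgue_rV.
Arguments lebesgue_rV R n _ : clear implicits.

Section euclidean.
Context {R : realType} {n : nat}.
Implicit Types (x y : 'rV[R]_n) (K : set 'rV[R]_n).

Definition dotrV x y : R := \sum_(i < n) x ord0 i * y ord0 i.

(* The norm [`|x|] of the library on ['rV[R]_n] is the sup norm. *)
Definition enorm x : R := Num.sqrt (dotrV x x).

Definition unit_sphere : set 'rV[R]_n := [set x | enorm x = 1].

Definition convex_body K :=
  [/\ compact K, convex_set (K : set (convex_lmodType 'rV[R]_n)) &
      K° !=set0].

Definition vol K : R := fine (lebesgue_rV R n K).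

Definition center_of_mass K : 'rV[R]_n :=
  \row_i ((vol K)^-1 * \int[lebesgue_rV R n]_(x in K) x ord0 i).

(* [L] is the isotropic constant L_K; it is determined by [K] when n > 0. *)
Definition isotropic K (L : R) :=
  [/\ convex_body K, center_of_mass K = 0, lebesgue_rV R n K = 1%E, 0 < L &
      forall theta, unit_sphere theta ->
        \int[lebesgue_rV R n]_(x in K) dotrV x theta ^+ 2 = L ^+ 2].

Definition radial_function (A : set 'rV[R]_n) (theta : 'rV[R]_n) : \bar R :=
  ereal_sup [set r%:E | r in [set r : R | 0 <= r /\ A (r *: theta)]].

Definition expi (t : R) : R[i] := (cos t +i* sin t)%C.

Definition fourier_transform (f : 'rV[R]_n -> R[i]) (y : 'rV[R]_n) : R[i] :=
  let g x := expi (- dotrV x y) * f x in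
  ((\int[lebesgue_rV R n]_x complex.Re (g x)) +i*
   (\int[lebesgue_rV R n]_x complex.Im (g x)))%C.

Definition char_fun K (x : 'rV[R]_n) : R[i] := (\1_K x)%:C%C.

(* Extended-real valued: the integral may be infinite when [p] is large. *)
Definition fourier_mean_radius (p : R) K (theta : 'rV[R]_n) : \bar R :=
  (((p / vol K)%:E * \int[lebesgue_measure]_(r in `]0%R, +oo[)
     (Normc.normc (fourier_transform (char_fun K) (r *: theta)) ^+ 2
      * r `^ (p - 1))%:E) `^ p^-1)%E.

Definition fourier_mean_body (p : R) K : set 'rV[R]_n :=
  [set x | exists theta r, [/\ unit_sphere theta, 0 <= r,
    (r%:E <= fourier_mean_radius p K theta)%E & x = r *: theta]].

Lemma dotrVZ (a b : R) x y : dotrV (a *: x) (b *: y) = a * b * dotrV x y.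
Proof.
by rewrite /dotrV mulr_sumr; apply: eq_bigr => i _; rewrite !mxE mulrACA.
Qed.

Lemma unit_sphere_dot theta : unit_sphere theta -> dotrV theta theta = 1.
Proof.
rewrite /unit_sphere/= /enorm => e1; rewrite -[LHS]sqr_sqrtr ?e1 ?expr1n//.
by apply: sumr_ge0 => i _; rewrite -expr2 sqr_ge0.
Qed.

Let mem_fourier_mean_body (p : R) K theta r : unit_sphere theta -> 0 <= r ->
  fourier_mean_body p K (r *: theta) <->
  (r%:E <= fourier_mean_radius p K theta)%E.
Proof.
move=> t1 r0; split; last by move=> rr; exists theta, r; split.
case=> u [s [u1 s0 su rtu]].
have rs : r = s.
  have : dotrV (r *: theta) (r *: theta) = dotrV (s *: u) (s *: u).
    by rewrite rtu.
  rewrite !dotrVZ (unit_sphere_dot t1) (unit_sphere_dot u1) !mulr1 -!expr2.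
  by move/eqP; rewrite eqrXn2// => /eqP.
move: rtu su; rewrite -{}rs; have [->|r_neq0] := eqVneq r 0.
  by move=> _ _; exact: poweR_ge0.
by move=> /(scalerI r_neq0) <-.
Qed.

Lemma radial_fourier_mean_body (p : R) K theta : unit_sphere theta ->
  radial_function (fourier_mean_body p K) theta =
  fourier_mean_radius p K theta.
Proof.
move=> t1; have mE r := @mem_fourier_mean_body p K theta r t1.
have : (0 <= fourier_mean_radius p K theta)%E by exact: poweR_ge0.
rewrite /radial_function; move: (fourier_mean_radius p K theta) mE => rho.
move: (fourier_mean_body p K) => F mE rho0.
apply/eqP; rewrite eq_le; apply/andP; split.
  by apply: ge_ereal_sup => _ [r [r0 /mE rr] <-]; exact: rr.
case: rho rho0 mE => [r| |]//= r0 mE.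
  apply: ereal_sup_ubound; exists r => //=; split; first by rewrite -lee_fin.
  by apply/mE; rewrite -?lee_fin.
rewrite leye_eq; apply/eqP/eqyP => A A0.
apply: ereal_sup_ubound; exists A => //=.
by split; [exact: ltW|apply/mE; [exact: ltW|exact: leey]].
Qed.

End euclidean.

(* Main.v *)
Require Import Defs.
From HB Require Import structures.
From mathcomp Require Import all_boot all_order all_algebra.
From mathcomp Require Import complex.
From mathcomp Require Import all_classical all_reals all_analysis measurable_realfun.
From mathcomp Require Import ring lra.

(* Let P be the law of <x, theta> for x uniform in K; then the Fourier transform
   of K along the line spanned by theta is the characteristic function of P,
   and P has mean 0 and variance L_K^2.

   With c3 = 1 the claim becomes two-sided bounds, up to constants, of
   p * int_0^oo |phi(r)|^2 r^(p-1) dr by L_K^(-p).  From below,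
   Re phi(r) >= 1 - r^2 L_K^2 / 2 >= 1/2 for r <= 1 / L_K.  From above,
   |phi|^2 is bounded for r <= 1 / L_K, and for r >= 1 / L_K one uses
   r^(p-1) <= L_K^(1-p) together with int_0^oo |phi|^2 <= C / L_K.

   The last estimate follows, by averaging |phi|^2 against the Fejer weight,
   from the small ball bound P [a, a+d[ <= 2 d / L_K.  For the latter, the
   Brunn-Minkowski inequality (multiplicative form, at midpoints) shows that
   half-line probabilities of P are log-concave; if an interval of length d has
   mass m, the tails of P seen from it decay like (1 - m)^j after j steps of
   length d, so L_K^2 <= E (X - a)^2 <= 4 d^2 / m^2.  *)

Set Implicit Arguments.
Unset Strict Implicit.
Unset Printing Implicit Defensive.

Import Order.TTheory GRing.Theory Num.Theory.
Import numFieldNormedType.Exports.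

Local Open Scope classical_set_scope.
Local Open Scope ring_scope.

(** * Brunn-Minkowski inequality *)

(** The dimension is felt only through one inequality for P, [P A * P B <= P C * P C] whenever [C]
    contains all midpoints between [A] and [B]. No density of P is ever formed: masses of half-lines
    and half-open intervals suffice, and this keeps the constants absolute. Integrability of |phi|^2
    is not known beforehand, hence the cut-off to [0, T] with weight 1 - s/T. For independent X and
    Y of law P, |phi(s)|^2 = E cos(s (X - Y)), so the weighted integral is the mean at u = X - Y of
    a kernel bounded by min(T, 2 / (T u^2)). Split into dyadic scales of u, this kernel meets the
    small ball bound in a geometric series whose sum does not depend on T. The p-th root turns a
    factor c into c^(1/p), which is the shape of the claim. The constants start from 1/8, that is
    1/4 for |phi|^2 times half of the integral of p r^(p-1), and from 210 = 208 + 2, where 208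
    bounds L_K times the integral of |phi|^2 and 2 bounds |phi|^2. Widening them to 1/9 and 211
    makes the inequalities strict. *)

Section measurable_level.
Context {R : realType} d (T : measurableType d).
Implicit Types f g : T -> R.

Lemma measurable_lt_set f g : measurable_fun setT f -> measurable_fun setT g ->
  measurable [set x | f x < g x].
Proof.
move=> mf mg; rewrite -[X in measurable X]setTI.
exact: (measurable_fun_ltr mf mg measurableT (Y := [set true])).
Qed.

Lemma measurable_le_set f g : measurable_fun setT f -> measurable_fun setT g ->
  measurable [set x | f x <= g x].
Proof.
move=> mf mg; rewrite -[X in measurable X]setTI.
exact: (measurable_fun_ler mf mg measurableT (Y := [set true])).
Qed.
End measurable_level.

Section lebesgue_line.
Context {R : realType}.
Local Notation mu := (@lebesgue_measure R).
Implicit Types (A B C : set (measurableTypeR R)) (a b c : R).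

Lemma measurable_affine c d :
  measurable_fun setT (fun x : measurableTypeR R => (c * x + d : measurableTypeR R)).
Proof.
by apply: measurable_funD => //; apply: measurable_funM => //.
Qed.

(** The rescaled pushforward [nu] agrees with Lebesgue measure on half-open intervals, and
    uniqueness extends this to all measurable sets. *)
Lemma lebesgue_measure_affine c d A : 0 < c -> measurable A ->
  mu [set x | A (c * x + d)] = ((c^-1)%:E * mu A)%E.
Proof.
move=> c0 mA.
have ci0 : 0 <= c by exact: ltW.
pose nu : {measure set (measurableTypeR R) -> \bar R} := mscale (NngNum ci0)
  (measure_function_pushforward__canonical__measure_function_Measure
     mu (measurable_affine c d)).
have : mu A = nu A.
  apply: lebesgue_measure_unique => // X [[u v] _ <-] /=.
  rewrite /nu /= /mscale /= /pushforward.
  rewrite (_ : _ @^-1` _ = `]((u - d) / c), ((v - d) / c)]%classic); last first.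
    apply/seteqP; split => x /=; rewrite !in_itv /= -?ltr_pdivrMr.
      by move=> /andP[ux xv]; rewrite ltr_pdivrMr// ler_pdivlMr//; apply/andP; split; lra.
    by rewrite ltr_pdivrMr// ler_pdivlMr// => /andP[ux xv]; apply/andP; split; lra.
  rewrite !lebesgue_measure_itv /= !lte_fin.
  rewrite ltr_pM2r ?invr_gt0// ltrD2r.
  by case: ifPn => // _; rewrite ?mule0// -!EFinD -EFinM; congr EFin; field; rewrite gt_eqF.
rewrite /nu /= /mscale /= /pushforward => ->.
by rewrite muleA -EFinM mulVf ?gt_eqF// mul1e.
Qed.

(* For [a] close to [sup A] and [b] close to [inf B], the sets (A + b) / 2 and
   (a + B) / 2 lie in [C] and overlap in an interval of length at most [e]. *)
Lemma brunn_minkowski_line A B C : measurable A -> measurable B -> measurable C ->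
  A !=set0 -> B !=set0 -> has_ubound A -> has_lbound B ->
  (forall a b, A a -> B b -> C ((a + b) / 2)) ->
  (mu A + mu B <= 2%:E * mu C)%E.
Proof.
move=> mA mB mC A0 B0 uA lB ABC.
apply/lee_addgt0Pr => e' e0'; pose e := e' / 2; have e0 : 0 < e by rewrite divr_gt0.
have [a Aa aA] : exists2 a, A a & sup A - e < a by apply: sup_adherent => //; split.
have [b Bb bB] : exists2 b, B b & b < inf B + e by apply: inf_adherent => //; split.
pose A' := [set x | A (2 * x - b)]; pose B' := [set x | B (2 * x - a)].
have mA' : measurable A'.
  by rewrite -[A']setTI; apply: measurable_affine.
have mB' : measurable B'.
  by rewrite -[B']setTI; apply: measurable_affine.
have eA : mu A' = (2^-1%:E * mu A)%E by apply: lebesgue_measure_affine.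
have eB : mu B' = (2^-1%:E * mu B)%E by apply: lebesgue_measure_affine.
have AB' : A' `&` B' `<=` `[(a + inf B) / 2, (sup A + b) / 2]%classic.
  move=> x [/= Ax Bx]; rewrite in_itv /=.
  have h1 := ub_le_sup uA Ax; have h2 := ge_inf lB Bx.
  by apply/andP; split; lra.
have mAB' : (mu (A' `&` B') <= e%:E)%E.
  apply: (@le_trans _ _ (mu `[(a + inf B) / 2, (sup A + b) / 2]%classic)).
    by apply: le_measure => //; rewrite inE//; exact: measurableI.
  rewrite lebesgue_measure_itv /= lte_fin; case: ifPn => // _.
    by rewrite -EFinD lee_fin; lra.
  by rewrite lee_fin ltW.
have sC : A' `|` B' `<=` C.
  move=> x [] /= h.
    by rewrite (_ : x = (2 * x - b + b) / 2); [exact: ABC|field].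
  by rewrite (_ : x = (a + (2 * x - a)) / 2); [exact: ABC|field].
have -> : mu A = (2%:E * mu A')%E by rewrite eA muleA -EFinM mulfV// mul1e.
have -> : mu B = (2%:E * mu B')%E by rewrite eB muleA -EFinM mulfV// mul1e.
rewrite -ge0_muleDr ?measure_ge0// (_ : e' = 2 * e); last by rewrite /e; field.
rewrite EFinM -ge0_muleDr ?measure_ge0 ?lee_fin ?(ltW e0)//; apply: lee_wpmul2l => //.
rewrite (measureDI mu mA' mB') addeAC -measureU//; last 2 first.
- exact: measurableD.
- by rewrite setDE -setIA setICl setI0.
apply: leeD => //; apply: le_measure; rewrite ?inE//.
  by apply: measurableU => //; exact: measurableD.
by apply: subset_trans sC => x [[] ? ?|?]; [left|right].
Qed.
End lebesgue_line.

(** * Layer-cake formula and the one-dimensional inequality for normalized functions *)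

Section layer_cake.
Context {R : realType}.
Local Notation mu := (@lebesgue_measure R).

Let undergraph d (T : measurableType d) (f : T -> R) :=
  [set z : T * measurableTypeR R | 0 <= z.2 /\ z.2 < f z.1].

Let measurable_undergraph d (T : measurableType d) (f : T -> R) :
  measurable_fun setT f -> measurable (undergraph f).
Proof.
move=> mf; have mf1 : measurable_fun setT (fun z : T * measurableTypeR R => f z.1).
  exact: measurableT_comp.
have m2 : measurable_fun setT (fun z : T * measurableTypeR R => z.2 : R).
  exact: measurable_snd.
have m0 : measurable_fun setT (fun z : T * measurableTypeR R => 0 : R) by [].
exact: measurableI (measurable_le_set m0 m2) (measurable_lt_set m2 mf1).
Qed.

(** Tonelli for the indicator of the undergraph: its sections are the intervals [[0, f x[] in one
    direction and the level sets of [f] in the other. *)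
Lemma layer_cake d (T : measurableType d)
    (m : {sigma_finite_measure set T -> \bar R}) (f : T -> R) :
  measurable_fun setT f -> (forall x, 0 <= f x) ->
  (\int[m]_x (f x)%:E = \int[mu]_(s in `[0%R, +oo[) m [set x | (s < f x)%R])%E.
Proof.
move=> mf f0.
have mU := measurable_undergraph mf.
pose F (z : T * measurableTypeR R) : \bar R := (\1_(undergraph f) z)%:E.
have mF : measurable_fun setT F.
  apply/measurable_EFinP; exact: measurable_indic.
have F0 z : (0 <= F z)%E by rewrite lee_fin indicE.
have := @fubini_tonelli _ _ _ _ _ m mu F mF F0.
rewrite /fubini_F /fubini_G => e12.
transitivity (\int[m]_x \int[mu]_y F (x, y))%E.
  apply: eq_integral => x _.
  rewrite (_ : (fun y => F (x, y)) = EFin \o \1_(`[0%R, f x[%classic)); last first.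
    apply/funext => y /=; rewrite /F !indicE; congr ((nat_of_bool _)%:R%:E).
    apply/idP/idP; rewrite !inE /undergraph /= in_itv /=; first by move=> [-> ->].
    by move=> /andP[].
  rewrite integral_indic// setIT. rewrite [RHS](@lebesgue_measure_itv R `[0%R, f x[) /= lte_fin.
  case: ltP => [_|]; first by rewrite -EFinD subr0.
  by move=> h; congr EFin; apply/eqP; rewrite eq_le h f0.
rewrite e12 [RHS]integral_mkcond; apply: eq_integral => y _.
rewrite /patch mem_setE in_itv /= andbT.
case: ifPn => y0.
  rewrite (_ : (fun x => F (x, y)) = EFin \o \1_([set x | (y < f x)%R])); last first.
    apply/funext => x /=; rewrite /F !indicE; congr ((nat_of_bool _)%:R%:E).
    apply/idP/idP; rewrite !inE /undergraph /=; first by move=> [].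
    by [].
  rewrite integral_indic ?setIT//.
  by apply: (@measurable_lt_set R _ _ (fun z => y) f).
rewrite integral0_eq// => x _; rewrite /F indicE memNset// /undergraph /= => -[].
by rewrite (negbTE y0).
Qed.

Lemma measurable_fun_levels d (T : measurableType d)
    (m : {sigma_finite_measure set T -> \bar R}) (f : T -> R) D :
  measurable_fun setT f ->
  measurable_fun D (fun s : measurableTypeR R => m [set x | (s < f x)%R]).
Proof.
move=> mf; apply: measurable_funTS.
have mf1 : measurable_fun setT (fun z : T * measurableTypeR R => f z.1).
  exact: measurableT_comp.
have m2 : measurable_fun setT (fun z : T * measurableTypeR R => z.2 : R).
  exact: measurable_snd.
have mU := measurable_lt_set m2 mf1.
have := @measurable_fun_ysection _ _ _ _ _ m _ mU.
congr (measurable_fun setT _); apply/funext => s /=.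
by congr (m _); apply/seteqP; split => x /=; rewrite /ysection /= inE.
Qed.

(** The layer-cake formula reduces the integrals to measures of level sets. Below level 1 those of
    [f] and [g] are non-empty, and the one-sided bounds on the supports make them bounded above and
    below respectively, so Brunn-Minkowski on the line applies level by level. The function [h] may
    exceed 1; its higher levels only help. *)
Lemma prekopa_leindler_line_normalized (f g h : measurableTypeR R -> R) (M : R) :
  measurable_fun setT f -> measurable_fun setT g -> measurable_fun setT h ->
  (forall x, 0 <= f x <= 1) -> (forall x, 0 <= g x <= 1) -> (forall x, 0 <= h x) ->
  (forall x, 0 < f x -> x <= M) -> (forall x, 0 < g x -> - M <= x) ->
  (forall s, s < 1 -> exists x, s < f x) -> (forall s, s < 1 -> exists x, s < g x) ->
  (forall (s : R) x y, 0 <= s -> s < f x -> s < g y -> s < h ((x + y) / 2)) ->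
  (\int[mu]_x (f x)%:E + \int[mu]_x (g x)%:E <= 2%:E * \int[mu]_x (h x)%:E)%E.
Proof.
move=> mf mg mh f01 g01 h0 fM gM f1 g1 fgh.
have lev (k : measurableTypeR R -> R) : measurable_fun setT k -> (forall x, 0 <= k x <= 1) ->
    (\int[mu]_x (k x)%:E = \int[mu]_(s in `[0%R, 1%R[) mu [set x | (s < k x)%R])%E.
  move=> mk k01; rewrite layer_cake//; last by move=> x; have /andP[] := k01 x.
  rewrite integral_mkcond [RHS]integral_mkcond; apply: eq_integral => s _.
  rewrite /patch !mem_setE !in_itv /= andbT.
  case: (leP 0 s) => //= s0; case: ltP => // s1.
  rewrite (_ : mkset _ = set0) ?measure0//.
  apply/seteqP; split => // x /= sk; have /andP[_ k1] := k01 x.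
  by have := lt_le_trans sk k1; rewrite ltNge s1.
rewrite (lev f)// (lev g)//.
have mset (k : measurableTypeR R -> R) s : measurable_fun setT k ->
    measurable [set x : measurableTypeR R | s < k x].
  move=> mk; by apply: (@measurable_lt_set R _ _ (fun z => s) k).
rewrite -ge0_integralD//; [|exact: measurable_fun_levels..].
apply: (@le_trans _ _ (2%:E * \int[mu]_(s in `[0%R, 1%R[) mu [set x | (s < h x)%R])%E); last first.
  apply: lee_wpmul2l => //; rewrite layer_cake//.
  apply: ge0_subset_integral => //; first exact: measurable_fun_levels.
  by move=> x /=; rewrite !in_itv /= andbT => /andP[].
rewrite -ge0_integralZl//; last exact: measurable_fun_levels.
apply: ge0_le_integral => //.
- by move=> s _; rewrite adde_ge0.
- by apply: emeasurable_funD; exact: measurable_fun_levels.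
- by apply: measurable_funeM; exact: measurable_fun_levels.
move=> s /=; rewrite in_itv /= => /andP[s0 s1].
apply: brunn_minkowski_line; rewrite ?mset//.
- exact: mset.
- exact: mset.
- exact: mset.
- exact: f1.
- exact: g1.
- by exists M => x /= sf; apply: fM; exact: le_lt_trans sf.
- by exists (- M) => x /= sg; apply: gM; exact: le_lt_trans sg.
- by move=> a b /= sf sg; exact: fgh.
Qed.

End layer_cake.

(** * Prekopa-Leindler on the line and Brunn-Minkowski in every dimension *)

Section brunn_minkowski.
Context {R : realType}.
Local Notation mu := (@lebesgue_measure R).
Local Notation leb n := (lebesgue_rV R n).

Let cube n (M : R) := [set x : 'rV[R]_n | forall i, `[- M, M]%classic (x ord0 i)].

Lemma measurable_cube n M : measurable (cube (n := n) M).
Proof.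
rewrite (_ : cube M = \bigcap_(i in [set: 'I_n])
    ((fun x : 'rV[R]_n => x ord0 i) @^-1` `[- M, M]%classic)).
  apply: fin_bigcap_measurable => // i _.
  by rewrite -[X in measurable X]setTI; exact: measurable_rV_coord.
by apply/seteqP; split => [x Ax i _|x Ax i]; exact: Ax.
Qed.

Lemma lebesgue_rV_cube_lty n M : (leb n (cube M) < +oo)%E.
Proof.
pose I : set R := `[- M, M]%classic.
have mI : forall i : 'I_n, measurable (I : set (measurableTypeR R)).
  by move=> _; exact: measurable_itv.
rewrite [ltLHS](lebesgue_rV_box mI).
suff /andP[] : (0 <= \prod_(i < n) mu I < +oo)%E by [].
elim/big_ind : _ => [|x y /andP[x0 xoo] /andP[y0 yoo]|i _].
- by rewrite lee01 ltry.
- by rewrite mule_ge0// lte_mul_pinfty// ge0_fin_numE.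
- by rewrite measure_ge0 lebesgue_measure_itv; case: ifPn => _; rewrite ?ltry// -EFinB ltry.
Qed.

(** The product measure is built by measuring fibres over the first factor; its uniqueness allows
    slicing by the last coordinate instead, which is what an induction on the dimension needs. *)
Lemma lebesgue_rVS_ysection n (A : set 'rV[R]_n.+1) : measurable A ->
  leb n.+1 A = (\int[mu]_t leb n (ysection (@rV_rcons R n @^-1` A) t))%E.
Proof.
move=> mA.
have mA' : measurable (@rV_rcons R n @^-1` A).
  by rewrite -[X in measurable X]setTI; exact: measurable_rV_rcons.
rewrite /= /pushforward.
exact: (product_measure_unique (m1 := leb n) (m2 := mu) (m' := (leb n \x^ mu)%E)
  (@product_measure2E _ _ _ _ _ (leb n) mu) mA').
Qed.

(* Once [f] and [g] are rescaled to have supremum 1, their level sets below 1 are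
   non-empty, and Brunn-Minkowski on the line bounds the arithmetic mean of the
   integrals, hence the geometric one. *)
Lemma prekopa_leindler_line (f g h : measurableTypeR R -> R) (M N : R) :
  measurable_fun setT f -> measurable_fun setT g -> measurable_fun setT h ->
  (forall x, 0 <= f x <= N) -> (forall x, 0 <= g x <= N) -> (forall x, 0 <= h x <= N) ->
  (forall x, 0 < f x -> `[- M, M]%classic x) -> (forall x, 0 < g x -> `[- M, M]%classic x) ->
  (forall x, 0 < h x -> `[- M, M]%classic x) ->
  (forall x y, f x * g y <= h ((x + y) / 2) ^+ 2) ->
  (\int[mu]_x (f x)%:E * \int[mu]_x (g x)%:E <=
   \int[mu]_x (h x)%:E * \int[mu]_x (h x)%:E)%E.
Proof.
move=> mf mg mh fN gN hN fM gM hM fgh.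
pose I : set (measurableTypeR R) := `[- M, M]%classic.
have mI : measurable I by exact: measurable_itv.
have fin (k : measurableTypeR R -> R) : measurable_fun setT k ->
    (forall x, 0 <= k x <= N) -> (forall x, 0 < k x -> I x) ->
    (\int[mu]_x (k x)%:E)%E \is a fin_num.
  move=> mk kN kM.
  have k0 x : 0 <= k x by have /andP[] := kN x.
  rewrite ge0_fin_numE; last by apply: integral_ge0 => x _; rewrite lee_fin.
  rewrite [ltLHS](_ : _ = \int[mu]_(x in I) (k x)%:E)%E; last first.
    rewrite [RHS]integral_mkcond; apply: eq_integral => x _.
    rewrite /patch mem_setE; case: ifPn => // /negP xM; congr EFin.
    apply/eqP; rewrite eq_le k0 andbT leNgt; apply/negP => /kM; exact: xM.
  apply: (@le_lt_trans _ _ (\int[mu]_(x in I) (cst N%:E x))%E).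
    apply: ge0_le_integral => //.
    - by move=> x _; rewrite lee_fin.
    - by apply/measurable_EFinP; exact: measurable_funTS.
    - by move=> x _; rewrite lee_fin; have /andP[] := kN x.
  rewrite integral_cst//= lebesgue_measure_itv.
  by case: ifPn => _; rewrite ?mule0// -EFinM ltry.
have f_fin := fin _ mf fN fM; have g_fin := fin _ mg gN gM; have h_fin := fin _ mh hN hM.
have [f_eq0|f_neq0] := eqVneq (\int[mu]_x (f x)%:E)%E 0%E.
  by rewrite f_eq0 mul0e mule_ge0// integral_ge0// => x _; rewrite lee_fin; have /andP[] := hN x.
have [g_eq0|g_neq0] := eqVneq (\int[mu]_x (g x)%:E)%E 0%E.
  by rewrite g_eq0 mule0 mule_ge0// integral_ge0// => x _; rewrite lee_fin; have /andP[] := hN x.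
have hsup (k : measurableTypeR R -> R) : (forall x, 0 <= k x <= N) ->
    (\int[mu]_x (k x)%:E != 0)%E -> has_sup (range k) /\ 0 < sup (range k).
  move=> kN k_neq0.
  have hs : has_sup (range k).
    by split; [exists (k 0), 0|exists N => _ [x _ <-]; have /andP[] := kN x].
  split => //; rewrite ltNge; apply/negP => s0; move/negP: k_neq0; apply; apply/eqP.
  apply: integral0_eq => x _; congr EFin; apply/eqP; rewrite eq_le.
  have /andP[-> _] := kN x; rewrite andbT; apply: le_trans s0.
  by apply: ub_le_sup; [case: hs|exists x].
have [fs F0] := hsup _ fN f_neq0; have [gs G0] := hsup _ gN g_neq0.
set F := sup (range f) in F0 fs; set G := sup (range g) in G0 gs.
(* From [f x > s * F] and [g y > s * G] one gets [h > s * q] at the midpoint, so [q] is the scale of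
   [h] that matches the normalizations of [f] and [g]. *)
pose q := Num.sqrt (F * G).
have q0 : 0 < q by rewrite sqrtr_gt0 mulr_gt0.
have q2 : q ^+ 2 = F * G by rewrite sqr_sqrtr// ltW// mulr_gt0.
have scale (k : measurableTypeR R -> R) c : measurable_fun setT k ->
    (forall x, 0 <= k x <= N) -> 0 < c ->
    (\int[mu]_x (k x / c)%:E = (c^-1)%:E * \int[mu]_x (k x)%:E)%E.
  move=> mk kN c0; rewrite -ge0_integralZl_EFin//.
  - by apply: eq_integral => x _; rewrite -EFinM mulrC.
  - by move=> x _; rewrite lee_fin; have /andP[] := kN x.
  - exact/measurable_EFinP.
  - by rewrite invr_ge0 ltW.
have mscal (k : measurableTypeR R -> R) c : measurable_fun setT k ->
  measurable_fun setT (fun x => k x / c).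
  by move=> mk; apply: measurable_funM.
have := @prekopa_leindler_line_normalized R (fun x => f x / F) (fun x => g x / G)
  (fun x => h x / q) M (mscal _ _ mf) (mscal _ _ mg) (mscal _ _ mh).
rewrite !scale// -(fineK f_fin) -(fineK g_fin) -(fineK h_fin) -!EFinM -!EFinD !lee_fin.
set a := fine _; set b := fine _; set c := fine _ => H.
have {}H : F^-1 * a + G^-1 * b <= 2 * (q^-1 * c).
  apply: H.
  - move=> x; have /andP[fx0 _] := fN x; rewrite divr_ge0 ?(ltW F0)//=.
    by rewrite ler_pdivrMr// mul1r; apply: ub_le_sup; [case: fs|exists x].
  - move=> x; have /andP[fx0 _] := gN x; rewrite divr_ge0 ?(ltW G0)//=.
    by rewrite ler_pdivrMr// mul1r; apply: ub_le_sup; [case: gs|exists x].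
  - by move=> x; have /andP[fx0 _] := hN x; rewrite divr_ge0 ?(ltW q0)//=.
  - move=> x; rewrite pmulr_lgt0 ?invr_gt0// => /fM /=; rewrite in_itv /=.
    by move=> /andP[].
  - move=> x; rewrite pmulr_lgt0 ?invr_gt0// => /gM /=; rewrite in_itv /=.
    by move=> /andP[].
  - move=> s s1.
    have e0 : 0 < (1 - s) * F by rewrite mulr_gt0// subr_gt0.
    have [_ [x _ <-] xs] := sup_adherent e0 fs.
    by exists x; rewrite ltr_pdivlMr//; rewrite -/F in xs; lra.
  - move=> s s1.
    have e0 : 0 < (1 - s) * G by rewrite mulr_gt0// subr_gt0.
    have [_ [x _ <-] xs] := sup_adherent e0 gs.
    by exists x; rewrite ltr_pdivlMr//; rewrite -/G in xs; lra.
  - move=> s x y s0; rewrite !ltr_pdivlMr// => sf sg.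
    have /andP[h0 _] := hN ((x + y) / 2).
    rewrite -(ltr_pXn2r (n := 2))// ?nnegrE ?mulr_ge0// ?(ltW q0)//.
    apply: lt_le_trans (fgh x y); rewrite exprMn q2.
    rewrite (_ : s ^+ 2 * (F * G) = (s * F) * (s * G)); last by ring.
    by apply: ltr_pM => //; rewrite mulr_ge0// ltW.
have a0 : 0 <= a.
  by rewrite fine_ge0// integral_ge0// => x _; rewrite lee_fin; have /andP[] := fN x.
have b0 : 0 <= b.
  by rewrite fine_ge0// integral_ge0// => x _; rewrite lee_fin; have /andP[] := gN x.
have c0 : 0 <= c.
  by rewrite fine_ge0// integral_ge0// => x _; rewrite lee_fin; have /andP[] := hN x.
have {}H : a * G + b * F <= 2 * c * q.
  have FG : 0 < F * G by rewrite mulr_gt0.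
  have -> : 2 * c * q = F * G * (2 * (q^-1 * c)).
    by rewrite -q2; field; rewrite gt_eqF.
  have -> : a * G + b * F = F * G * (F^-1 * a + G^-1 * b).
    by field; rewrite !gt_eqF.
  by rewrite ler_pM2l.
(* Arithmetic-geometric mean: the left side is at least [4 * (a * G) * (b * F)], the right side is
   [4 * c ^+ 2 * (F * G)], and [F * G] cancels. *)
have H2 : (a * G + b * F) ^+ 2 <= (2 * c * q) ^+ 2.
  by rewrite lerXn2r// nnegrE ?addr_ge0 ?mulr_ge0// ltW.
rewrite -(ler_pM2r (mulr_gt0 F0 G0)).
rewrite !exprMn q2 in H2; have := sqr_ge0 (a * G - b * F).
rewrite !expr2 in H2 *; nra.
Qed.

(** Induction on the dimension. The slices of [A], [B], [C] at heights s, t and (s + t) / 2 satisfy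
    the midpoint hypothesis, so by induction the slice volumes [k] satisfy the hypothesis of
    Prekopa-Leindler on the line. The common cube makes these volumes finite, uniformly bounded and
    supported in a fixed interval. *)
Lemma brunn_minkowski_rV n (A B C : set 'rV[R]_n) M :
  measurable A -> measurable B -> measurable C ->
  A `<=` cube M -> B `<=` cube M -> C `<=` cube M ->
  (forall a b, A a -> B b -> C (2^-1 *: (a + b))) ->
  (leb n A * leb n B <= leb n C * leb n C)%E.
Proof.
elim: n A B C => [|n IH] A B C mA mB mC AM BM CM ABC.
  rewrite /= !diracE -!EFinM lee_fin.
  case: (boolP (0 \in A)) => [|_]; last by rewrite mul0r mulr_ge0.
  case: (boolP (0 \in B)) => [|_]; last by rewrite mulr0 mulr_ge0.
  rewrite !inE => B0 A0; rewrite mem_set ?mulr1//.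
  by have := ABC _ _ A0 B0; rewrite addr0 scaler0.
rewrite !lebesgue_rVS_ysection//.
have mS X t : measurable X -> measurable (ysection (@rV_rcons R n @^-1` X) t).
  move=> mX; apply: measurable_ysection.
  by rewrite -[X in measurable X]setTI; exact: measurable_rV_rcons.
have SM X t : X `<=` cube M -> ysection (@rV_rcons R n @^-1` X) t `<=` cube M.
  move=> XM x; rewrite /ysection /= inE /= => /XM xM i.
  by have := xM (lift ord_max i); rewrite mxE liftK.
have Sfin X t : measurable X -> X `<=` cube M ->
    leb n (ysection (@rV_rcons R n @^-1` X) t) \is a fin_num.
  move=> mX XM; rewrite ge0_fin_numE ?measure_ge0//.
  apply: le_lt_trans (lebesgue_rV_cube_lty n M).
  by apply: le_measure; rewrite ?inE; [exact: mS|exact: measurable_cube|exact: SM].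
pose k X t := fine (leb n (ysection (@rV_rcons R n @^-1` X) t)).
have kE X : measurable X -> X `<=` cube M ->
    (\int[mu]_t leb n (ysection (@rV_rcons R n @^-1` X) t) = \int[mu]_t (k X t)%:E)%E.
  by move=> mX XM; apply: eq_integral => t _; rewrite fineK// Sfin.
rewrite !kE//.
have k_ub X t : measurable X -> X `<=` cube M ->
    0 <= k X t <= fine (leb n (cube M)).
  move=> mX XM; rewrite fine_ge0//= fine_le ?Sfin//.
    by rewrite ge0_fin_numE ?lebesgue_rV_cube_lty.
  by apply: le_measure; rewrite ?inE; [exact: mS|exact: measurable_cube|exact: SM].
have mk X : measurable X -> measurable_fun setT (k X).
  move=> mX; apply: measurableT_comp => //.
  apply: measurable_fun_ysection.
  by rewrite -[Y in measurable Y]setTI; exact: measurable_rV_rcons.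
have kM X t : measurable X -> X `<=` cube M -> 0 < k X t -> `[- M, M]%classic t.
  move=> mX XM kX0; have : ysection (@rV_rcons R n @^-1` X) t !=set0.
    by apply/set0P; apply: contraTneq kX0 => h; rewrite /k h measure0 ltxx.
  move=> [x]; rewrite /ysection /= inE /= => /XM /(_ ord_max).
  by rewrite mxE unlift_none.
apply: (@prekopa_leindler_line _ _ _ M (fine (leb n (cube M)))).
- exact: mk.
- exact: mk.
- exact: mk.
- by move=> t; exact: k_ub.
- by move=> t; exact: k_ub.
- by move=> t; exact: k_ub.
- by move=> t; exact: kM.
- by move=> t; exact: kM.
- by move=> t; exact: kM.
move=> s t; rewrite -lee_fin expr2 !EFinM !fineK ?Sfin//.
apply: IH; [exact: mS|exact: mS|exact: mS|exact: SM|exact: SM|exact: SM|].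
move=> a b; rewrite /ysection /= !inE /= => Aa Bb.
have := ABC _ _ Aa Bb; congr C; apply/rowP => i; rewrite !mxE.
by case: (unlift _ _) => [j|] /=; rewrite ?mxE// mulrC.
Qed.
End brunn_minkowski.

(** * One-dimensional marginals *)

Section borel_rV.
Context {R : realType} {n : nat}.
Implicit Types (U K : set 'rV[R]_n).

(** The sigma-algebra is generated by the coordinates while openness refers to the sup norm; the two
    meet in writing [U] as a countable union of boxes with rational corners. *)
Lemma open_measurable_rV U : open U -> measurable U.
Proof.
move=> oU.
pose Box (q : 'rV[rat]_n * 'rV[rat]_n) : set 'rV[R]_n :=
  [set x | forall i, `]ratr (q.1 ord0 i), ratr (q.2 ord0 i)[%classic (x ord0 i)].
have mBox q : measurable (Box q).
  rewrite (_ : Box q = \bigcap_(i in [set: 'I_n])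
    ((fun x : 'rV[R]_n => x ord0 i) @^-1`
      `]ratr (q.1 ord0 i), ratr (q.2 ord0 i)[%classic)).
    apply: fin_bigcap_measurable => // i _.
    by rewrite -[X in measurable X]setTI; exact: measurable_rV_coord.
  by apply/seteqP; split => [x Ax i _|x Ax i]; exact: Ax.
rewrite (_ : U = \bigcup_q if `[< Box q `<=` U >] then Box q else set0).
  by apply: countable_bigcupT_measurable => // q; case: ifPn.
apply/seteqP; split => [x Ux|x [q _]]; last first.
  by case: ifPn => // /asboolP; apply.
have /nbhs_ballP[e /= e0 xeU] : nbhs x U by exact: open_nbhs_nbhs.
have /choice[a xa] : forall i, exists q : rat, ratr q \in `]x ord0 i - e, x ord0 i[.
  by move=> i; have /rat_in_itvoo[q hq] : x ord0 i - e < x ord0 i by [lra]; exists q.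
have /choice[b xb] : forall i, exists q : rat, ratr q \in `]x ord0 i, x ord0 i + e[.
  by move=> i; have /rat_in_itvoo[q hq] : x ord0 i < x ord0 i + e by [lra]; exists q.
exists (\row_i a i, \row_i b i) => //.
have -> : `[< Box (\row_i a i, \row_i b i) `<=` U >].
  apply/asboolP => y yB; apply: xeU; split => // i j.
  rewrite ord1 /ball /= ltr_norml; have := yB j; rewrite /= !mxE in_itv /=.
  by move: (xa j) (xb j); rewrite !in_itv /= => /andP[? ?] /andP[? ?] /andP[? ?]; lra.
move=> i; rewrite /= !mxE in_itv /=.
by move: (xa i) (xb i); rewrite !in_itv /= => /andP[_ ->] /andP[->].
Qed.

Lemma compact_measurable_rV K : compact K -> measurable K.
Proof.
move=> cK; rewrite -[K]setCK; apply: measurableC; apply: open_measurable_rV.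
by apply: closed_openC; apply: compact_closed => //; exact: norm_hausdorff.
Qed.

Lemma compact_rV_bounded K : compact K ->
  exists M : R, forall x i, K x -> `[- M, M]%classic (x ord0 i).
Proof.
move=> /compact_bounded[M [_ MK]]; exists (M + 1) => x i Kx /=.
have := MK (M + 1); rewrite ltrDl ltr01 => /(_ isT x Kx) xM.
rewrite in_itv /= -ler_norml; apply: le_trans xM.
rewrite /Num.norm /= mx_normrE.
exact: (@le_bigmax _ _ _ 0 (fun ij : 'I_1 * 'I_n => `|x ij.1 ij.2|) (ord0, i)).
Qed.

Lemma measurable_dotrV (theta : 'rV[R]_n) :
  measurable_fun setT (dotrV^~ theta).
Proof.
apply: measurable_sum => i; apply: measurable_funM => //.
exact: measurable_rV_coord.
Qed.

Lemma dotrV_midpoint (a b theta : 'rV[R]_n) :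
  dotrV (2^-1 *: (a + b)) theta = (dotrV a theta + dotrV b theta) / 2.
Proof.
rewrite /dotrV -big_split /= mulr_suml; apply: eq_bigr => i _.
by rewrite !mxE; field.
Qed.

Lemma convex_rV_midpoint K : convex_set (K : set (convex_lmodType 'rV[R]_n)) ->
  forall a b, K a -> K b -> K (2^-1 *: (a + b)).
Proof.
move=> cK a b Ka Kb.
have h : (0 <= (2^-1 : R) <= 1) by lra.
have := cK a b (Itv01 (andP h).1 (andP h).2); rewrite !inE => /(_ Ka Kb).
have -> : conv (Itv01 (andP h).1 (andP h).2) (a : convex_lmodType 'rV[R]_n) b
    = 2^-1 *: a + (1 - 2^-1) *: b by [].
by rewrite scalerDr (_ : 1 - 2^-1 = 2^-1 :> R)//; lra.
Qed.

End borel_rV.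

(** * Law of a linear functional on a set of volume one *)

Section marginal.
Context {R : realType} {n : nat} (K : set 'rV[R]_n) (theta : 'rV[R]_n).
Hypothesis mK : measurable K.
Hypothesis K1 : lebesgue_rV R n K = 1%E.

Definition marginal : set (measurableTypeR R) -> \bar R :=
  pushforward (mrestr (lebesgue_rV R n) mK) (dotrV^~ theta).

Let marginal0 : marginal set0 = 0%E.
Proof. by rewrite /marginal /pushforward preimage_set0 measure0. Qed.

Let marginal_ge0 A : (0 <= marginal A)%E.
Proof. by rewrite /marginal /pushforward; exact: measure_ge0. Qed.

Let marginal_sigma_additive : semi_sigma_additive marginal.
Proof.
exact: (@measure_semi_sigma_additive _ _ _
  (measure_function_pushforward__canonical__measure_function_Measure
    (mrestr (lebesgue_rV R n) mK) (@measurable_dotrV _ _ theta))).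
Qed.

HB.instance Definition _ := isMeasure.Build _ _ _ marginal
  marginal0 marginal_ge0 marginal_sigma_additive.

Let marginalT : marginal setT = 1%E.
Proof. by rewrite /marginal /pushforward preimage_setT /mrestr setTI. Qed.

HB.instance Definition _ := Measure_isProbability.Build _ _ _ marginal marginalT.

Definition marginal_probability : probability (measurableTypeR R) R := marginal.

Lemma marginalE (A : set R) : marginal A = lebesgue_rV R n (K `&` [set x | A (dotrV x theta)]).
Proof. by rewrite /marginal /pushforward /mrestr /= setIC. Qed.

(** Change of variables for the pushforward, followed by removal of the part of the preimage of [I]
    outside [K], which the restricted measure does not see. Boundedness is asked of [g] on [I]
    alone, so that [x] and [x ^+ 2] are covered when [I] is a bounded interval. *)
Lemma integral_marginal (g : R -> R) (I : set R) :
  measurable I -> (forall x, K x -> I (dotrV x theta)) ->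
  measurable_fun setT g -> [bounded g x | x in I] ->
  \int[marginal_probability]_(x in I) g x =
  \int[lebesgue_rV R n]_(x in K) g (dotrV x theta).
Proof.
move=> mI KI mg bg.
have mX : measurable_fun setT (dotrV^~ theta : 'rV[R]_n -> measurableTypeR R).
  exact: measurable_dotrV.
have mXI : measurable (dotrV^~ theta @^-1` I) by rewrite -[X in measurable X]setTI; exact: mX.
have mgX : measurable_fun setT (g \o dotrV^~ theta) by exact: measurableT_comp.
rewrite /Rintegral; congr fine.
pose m := mrestr (lebesgue_rV R n) mK.
have im : m.-integrable (dotrV^~ theta @^-1` I) (EFin \o g \o dotrV^~ theta).
  apply: measurable_bounded_integrable => //.
  - rewrite /m /= /mrestr; apply: (@le_lt_trans _ _ (lebesgue_rV R n K)); last by rewrite K1 ltry.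
    by apply: le_measure; rewrite ?inE//; exact: measurableI.
  - exact: measurable_funTS.
  - case: bg => M [Mr bM]; exists M; split => // x Mx y /= Iy; exact: (bM x Mx).
have mEg : measurable_fun setT (EFin \o g : measurableTypeR R -> _) by exact/measurable_EFinP.
transitivity (\int[m]_(x in dotrV^~ theta @^-1` I) (EFin \o g \o dotrV^~ theta) x)%E.
  exact: (integral_pushforward mX mEg im mI).
pose N := (dotrV^~ theta @^-1` I) `\` K.
have mN : measurable N by exact: measurableD.
have N0 : m N = 0%E by rewrite /m /mrestr /= /N setDE -setIA setICl setI0 measure0.
rewrite (negligible_integral mN mXI im N0).
have -> : (dotrV^~ theta @^-1` I) `\` N = K.
  apply/seteqP; split => x /=; rewrite /N /=.
    by move=> [Ix h]; apply: contrapT => nK; apply: h.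
  by move=> Kx; split; [exact: KI|move=> []].
by apply: eq_measure_integral => A mA AK; rewrite /m /= /mrestr setIidl.
Qed.

End marginal.

Section marginal_convex_body.
Context {R : realType} {n : nat} (K : set 'rV[R]_n) (theta : 'rV[R]_n).
Hypothesis mK : measurable K.
Hypothesis K1 : lebesgue_rV R n K = 1%E.
Hypothesis bK : exists M : R, forall x i, K x -> `[- M, M]%classic (x ord0 i).
Hypothesis cK : forall a b, K a -> K b -> K (2^-1 *: (a + b)).
Local Notation P := (marginal_probability theta mK K1).

(** Brunn-Minkowski for the parts of [K] lying over [A], [B] and [C]: midpoints stay in [K] by
    convexity, and [dotrV] maps midpoints to midpoints. *)
Lemma marginal_log_concave (A B C : set (measurableTypeR R)) :
  measurable A -> measurable B -> measurable C ->
  (forall a b, A a -> B b -> C ((a + b) / 2)) ->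
  (P A * P B <= P C * P C)%E.
Proof.
move=> mA mB mC ABC; have [M KM] := bK.
have mp (E : set (measurableTypeR R)) :
    measurable E -> measurable [set x | E (dotrV x theta)].
  by move=> mE; rewrite -[X in measurable X]setTI; exact: measurable_dotrV.
rewrite /marginal_probability /= !marginalE.
apply: (@brunn_minkowski_rV _ _ _ _ _ M);
  [by apply: measurableI => //; exact: mp..|idtac|idtac|idtac|].
- by move=> x [Kx _] i; exact: KM.
- by move=> x [Kx _] i; exact: KM.
- by move=> x [Kx _] i; exact: KM.
move=> a b [Ka Aa] [Kb Bb]; split; first exact: cK.
by rewrite /= dotrV_midpoint; exact: ABC.
Qed.

Lemma marginal_bounded : exists2 M : R, 0 < M &
  forall x, K x -> `[- M, M]%classic (dotrV x theta).
Proof.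
have [M KM] := bK.
exists (`|\sum_(i < n) `|M| * `|theta ord0 i| | + 1); first by rewrite ltr_wpDl.
move=> x Kx; rewrite /= in_itv /= -ler_norml.
apply: (@le_trans _ _ (`|\sum_(i < n) `|M| * `|theta ord0 i| |)); last by rewrite lerDl.
apply: le_trans (ler_norm _); rewrite /dotrV; apply: le_trans (ler_norm_sum _ _ _) _.
apply: ler_sum => i _; rewrite normrM ler_wpM2r//.
by have := KM x i Kx; rewrite /= in_itv /= -ler_norml => /le_trans; apply; exact: ler_norm.
Qed.
End marginal_convex_body.

(** * Small ball probabilities *)

Section log_concave_decay.
Context {R : realType}.
Implicit Types (u : nat -> R) (m q d y : R).

(** Log-concavity makes the successive ratios non-increasing, and the first one is at most [1 - m]
    because [u 0 - m <= (1 - m) * u 0] when [u 0 <= 1]. Ratios are avoided in the proof, as [u] may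
    vanish from some index on. *)
Lemma log_concave_geometric u m : m <= 1 -> (forall j, 0 <= u j) ->
  (forall j, u j.+1 <= u j) -> (forall j, u j * u j.+2 <= u j.+1 ^+ 2) ->
  u 0%N <= 1 -> u 1%N <= u 0%N - m -> 0 <= m ->
  forall j, u j <= (1 - m) ^+ j.
Proof.
move=> m1 u0 ud ulc u01 u1 m0.
have step j : u j.+1 <= (1 - m) * u j.
  elim: j => [|j IH]; first by have := ler_wpM2l m0 u01; lra.
  have [uj|uj] := ltP 0 (u j); last first.
    have uj0 : u j.+2 = 0.
      by apply/eqP; rewrite eq_le u0 andbT (le_trans (ud _))// (le_trans (ud _)).
    by rewrite uj0 mulr_ge0// subr_ge0.
  rewrite -(ler_pM2l uj); apply: le_trans (ulc j) _.
  rewrite expr2 mulrA ler_wpM2r// (le_trans IH)//; lra.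
elim=> [|j IH]; first by rewrite expr0.
by rewrite exprS (le_trans (step j))// ler_wpM2l// subr_ge0.
Qed.

(** The full series sums to (1 + q) / (1 - q)^2. The closed form of the partial sums, proved by
    induction, differs from it by a term of known sign. *)
Lemma sum_odd_geometric q (J : nat) : 0 <= q < 1 ->
  (1 - q) ^+ 2 * \sum_(j < J) (2 * j + 1)%:R * q ^+ j <= 2.
Proof.
move=> /andP[q0 q1].
have -> : (1 - q) ^+ 2 * \sum_(j < J) (2 * j + 1)%:R * q ^+ j =
    1 + q - q ^+ J * ((2 * J + 1)%:R - ((2 * J)%:R - 1) * q).
  elim: J => [|J IH]; first by rewrite big_ord0 expr0 mulr0 muln0; ring.
  rewrite big_ord_recr /= mulrDr IH (exprS q).
  by rewrite (natrD _ (2 * J)) (natrD _ (2 * J.+1)) !(natrM _ 2) -(natr1 J); ring.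
have : 0 <= q ^+ J * ((2 * J + 1)%:R - ((2 * J)%:R - 1) * q).
  rewrite mulr_ge0 ?exprn_ge0// natrD.
  have : (2 * J)%:R * q <= (2 * J)%:R * 1 :> R by rewrite ler_wpM2l// ltW.
  by lra.
by lra.
Qed.

Lemma sum_odd (J : nat) : \sum_(j < J) (2 * j + 1)%:R = J%:R ^+ 2 :> R.
Proof.
elim: J => [|J IH]; first by rewrite big_ord0 expr0n.
by rewrite big_ord_recr /= IH natrD natrM -(natr1 J); ring.
Qed.

(** A staircase above the square: for y between k d and (k + 1) d the active odd numbers add up to
    (k + 1)^2. Being a combination of indicators of tails, the staircase turns tail probabilities
    into a bound on a second moment. *)
Lemma sqr_le_sum_odd d y (J : nat) : 0 < d -> 0 <= y <= J%:R * d ->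
  y ^+ 2 <= d ^+ 2 * \sum_(j < J) (2 * j + 1)%:R * (j%:R * d < y)%R%:R.
Proof.
move=> d0; elim: J => [|J IH] /andP[y0 yJ].
  have -> : y = 0 by apply/eqP; rewrite eq_le y0 andbT; move: yJ; rewrite mul0r.
  by rewrite big_ord0 mulr0 expr0n.
have [yJ'|yJ'] := leP y (J%:R * d).
  apply: le_trans (IH _) _; first by rewrite y0.
  by rewrite ler_wpM2l ?sqr_ge0// big_ord_recr /= lerDl mulr_ge0.
rewrite (eq_bigr (fun j : 'I_J.+1 => (2 * j + 1)%:R)); last first.
  move=> j _; rewrite (_ : (_ < y)%R = true) ?mulr1//; apply: le_lt_trans yJ'.
  by rewrite ler_wpM2r ?(ltW d0)// ler_nat -ltnS.
rewrite sum_odd -exprMn lerXn2r ?nnegrE//; first by rewrite mulr_ge0// ltW.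
by rewrite mulrC.
Qed.
End log_concave_decay.

Section small_ball.
Context {R : realType} (P : probability (measurableTypeR R) R) (M L : R).
Let I : set (measurableTypeR R) := `[- M, M]%classic.
Hypothesis M0 : 0 < M.
Hypothesis L0 : 0 < L.
Hypothesis PI : P I = 1%E.
Hypothesis mean : \int[P]_(x in I) x = 0.
Hypothesis second_moment : \int[P]_(x in I) x ^+ 2 = L ^+ 2.
Hypothesis lc : forall A B C : set (measurableTypeR R),
  measurable A -> measurable B -> measurable C ->
  (forall a b, A a -> B b -> C ((a + b) / 2)) -> (P A * P B <= P C * P C)%E.

Let mI : measurable I. Proof. exact: measurable_itv. Qed.

Let pr A := fine (P A).

Let prE A : measurable A -> P A = (pr A)%:E.
Proof. by move=> mA; rewrite /pr fineK// fin_num_measure. Qed.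

Let pr_le A B : measurable A -> measurable B -> A `<=` B -> pr A <= pr B.
Proof. by move=> mA mB AB; rewrite /pr fine_le ?fin_num_measure// le_measure ?inE. Qed.

Let pr1 A : measurable A -> pr A <= 1.
Proof. by move=> mA; rewrite -lee_fin -prE// probability_le1. Qed.

Let pr0 A : 0 <= pr A. Proof. exact: fine_ge0. Qed.

Let integrableI (f : measurableTypeR R -> R) (B : R) : measurable_fun setT f ->
  (forall x, I x -> `|f x| <= B) -> P.-integrable I (EFin \o f).
Proof.
move=> mf fB; apply: measurable_bounded_integrable => //.
- by rewrite (le_lt_trans (probability_le1 _ _)) ?ltry.
- exact: measurable_funTS.
- exists B; split; first exact: num_real.
  by move=> c Bc x /= Ix; apply: le_trans (fB x Ix) (ltW Bc).
Qed.

(** The cross term vanishes by [mean], so recentring at [a] cannot decrease the second moment. *)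
Let variance_ge a : \int[P]_(x in I) (x - a) ^+ 2 = L ^+ 2 + a ^+ 2.
Proof.
have Ib x : I x -> `|x| <= M by rewrite /I /= in_itv /= ler_norml.
have i1 : P.-integrable I (EFin \o id) by apply: (@integrableI _ M).
have i2 : P.-integrable I (EFin \o (fun x => x ^+ 2)).
  apply: (@integrableI _ (M ^+ 2)) => //.
  by move=> x Ix; rewrite normrX lerXn2r ?nnegrE ?Ib ?(ltW M0).
have i3 : P.-integrable I (EFin \o (fun x : measurableTypeR R => (- (2 * a)) * x)).
  apply: (@integrableI _ (`|- (2 * a)| * M)); first exact: measurable_funM.
  by move=> x Ix; rewrite normrM ler_wpM2l ?Ib.
have i4 : P.-integrable I (EFin \o (fun x : measurableTypeR R => a ^+ 2)).
  by apply: (@integrableI _ (`|a ^+ 2|)) => // x _.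
have i34 : P.-integrable I (EFin \o (fun x : measurableTypeR R => (- (2 * a)) * x + a ^+ 2)).
  exact: (integrableD mI i3 i4).
transitivity (\int[P]_(x in I) (x ^+ 2 + ((- (2 * a)) * x + a ^+ 2))).
  by apply: eq_Rintegral => x _; ring.
rewrite RintegralD// RintegralD// RintegralZl// mean second_moment Rintegral_cst//.
by rewrite /= PI /= mulr0 add0r mulr1.
Qed.

Let pr_lc (A B C : set (measurableTypeR R)) : measurable A -> measurable B -> measurable C ->
  (forall a b, A a -> B b -> C ((a + b) / 2)) -> pr A * pr B <= pr C ^+ 2.
Proof.
by move=> mA mB mC ABC; rewrite -lee_fin expr2 !EFinM -!prE//; exact: lc.
Qed.

Lemma small_ball (a d : R) : 0 < d -> fine (P `[a, a + d[%classic) <= 2 * d / L.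
Proof.
move=> d0; rewrite -/(pr _); set m := pr _.
have [->|m_neq0] := eqVneq m 0; first by rewrite divr_ge0 ?mulr_ge0 // ltW.
have m0 : 0 < m by rewrite lt_neqAle eq_sym m_neq0 pr0.
(* [G j] and [H j] are the masses of the two tails at distance [j * d] from the
   interval; going from step 0 to step 1 loses exactly the mass [m]. *)
pose G j := pr `[a + j%:R * d, +oo[%classic.
pose H j := pr `]-oo, a + d - j%:R * d[%classic.
have S j : j.+1%:R = j%:R + 1 :> R by rewrite -addn1 natrD.
have Gdec j : G j <= (1 - m) ^+ j.
  apply: log_concave_geometric => //.
  - exact: pr1.
  - by move=> k; exact: pr0.
  - move=> k; rewrite /G; apply: pr_le => // x /=; rewrite !in_itv /= !andbT S.
    by apply: le_trans; lra.
  - move=> k; rewrite /G; apply: pr_lc => // x y /=.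
    by rewrite !in_itv /= !andbT (S k.+1) (S k); lra.
  - exact: pr1.
  - rewrite /G /m mul0r addr0 mul1r lerBrDr -lee_fin EFinD -!prE// -measureU//.
      apply: le_measure; rewrite ?inE//; first exact: measurableU.
      by move=> x /= []; rewrite !in_itv /= ?andbT; [|case/andP]; lra.
    by apply/seteqP; split => // x /= []; rewrite !in_itv /= andbT => ? /andP[]; lra.
  - exact: ltW.
have Hdec j : H j <= (1 - m) ^+ j.
  apply: log_concave_geometric => //.
  - exact: pr1.
  - by move=> k; exact: pr0.
  - move=> k; rewrite /H; apply: pr_le => // x /=; rewrite !in_itv /= S; lra.
  - move=> k; rewrite /H; apply: pr_lc => // x y /=; rewrite !in_itv /= (S k.+1) (S k); lra.
  - exact: pr1.
  - rewrite /H /m mul0r subr0 mul1r addrK lerBrDr -lee_fin EFinD -!prE// -measureU//.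
      apply: le_measure; rewrite ?inE//; first exact: measurableU.
      by move=> x /= []; rewrite !in_itv /= ?andbT; [|case/andP]; lra.
    by apply/seteqP; split => // x /= []; rewrite !in_itv /= => ? /andP[]; lra.
  - exact: ltW.
(* [J] steps of length [d] lead from [a] past both ends of the support, so the finite staircase [W],
   with its two families of tails, dominates the square on all of [I]. *)
pose J := (Num.truncn ((M + `|a| + d) / d)).+1.
have Jd : M + `|a| + d <= J%:R * d.
  rewrite -ler_pdivrMr// ltW//; apply: truncnS_gt.
pose W (x : measurableTypeR R) := d ^+ 2 * \sum_(j < J) (2 * j + 1)%:R *
  (\1_(`[a + j%:R * d, +oo[%classic) x + \1_(`]-oo, a + d - j%:R * d[%classic) x).
have mW : measurable_fun setT W.
  apply: measurable_funM => //; apply: measurable_sum => j.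
  apply: measurable_funM => //.
  by apply: measurable_funD; apply: measurable_indic.
have xW x : I x -> (x - a) ^+ 2 <= W x.
  rewrite /I /= in_itv /= => /andP[x1 x2]; have a1 := ler_norm a; have a2 := ler_norm (- a).
  rewrite normrN in a2.
  have [ax|xa] := leP a x.
    apply: le_trans (@sqr_le_sum_odd _ d _ J d0 _) _; first by apply/andP; split; lra.
    rewrite ler_wpM2l ?sqr_ge0//; apply: ler_sum => j _; rewrite ler_wpM2l//.
    apply: (@le_trans _ _ (\1_(`[a + j%:R * d, +oo[%classic) x)); last by rewrite lerDl.
    rewrite indicE mem_setE in_itv /= andbT ler_nat.
    by case: (ltP _ _) => // h; rewrite (_ : _ <= x)//; lra.
  (* For [x < a] the distance is [a - x]; if it exceeds [j%:R * d] then [x] lies in the j-th left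
     half-line, with a margin [d] to spare. *)
  rewrite -sqrrN opprB.
  apply: le_trans (@sqr_le_sum_odd _ d _ J d0 _) _; first by apply/andP; split; lra.
  rewrite ler_wpM2l ?sqr_ge0//; apply: ler_sum => j _; rewrite ler_wpM2l//.
  apply: (@le_trans _ _ (\1_(`]-oo, a + d - j%:R * d[%classic) x)); last by rewrite lerDr.
  rewrite indicE mem_setE in_itv /= ler_nat.
  by case: (ltP _ _) => // h; rewrite (_ : x < _)//; lra.
have key : L ^+ 2 <= d ^+ 2 * \sum_(j < J) (2 * j + 1)%:R * (G j + H j).
  apply: (@le_trans _ _ (\int[P]_(x in I) (x - a) ^+ 2)).
    by rewrite variance_ge lerDl sqr_ge0.
  have iI : P.-integrable I (EFin \o (fun x : measurableTypeR R => (x - a) ^+ 2)).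
    apply: (@integrableI _ ((M + `|a|) ^+ 2)).
      by apply: measurable_funX; exact: measurable_funB.
    move=> x; rewrite /I /= in_itv /= -ler_norml => xM.
    rewrite normrX lerXn2r ?nnegrE ?addr_ge0 ?(ltW M0)//.
    by rewrite (le_trans (ler_normB _ _))// lerD2r.
  rewrite -lee_fin /Rintegral fineK; last exact: integrable_fin_num.
  have W0 x : 0 <= W x.
    by rewrite mulr_ge0 ?sqr_ge0// sumr_ge0// => j _; rewrite mulr_ge0// addr_ge0// indicE.
  apply: (@le_trans _ _ (\int[P]_x (W x)%:E)%E).
    apply: (@le_trans _ _ (\int[P]_(x in I) (W x)%:E)%E).
      apply: ge0_le_integral => //.
      - by move=> x _; rewrite lee_fin sqr_ge0.
      - by apply/measurable_EFinP; apply: measurable_funX; exact: measurable_funB.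
      - by apply/measurable_EFinP; exact: measurable_funTS.
    have sub := @ge0_subset_integral _ _ _ P I setT mI measurableT (EFin \o W).
    apply: sub => //; first exact/measurable_EFinP.
    by move=> x _; rewrite lee_fin.
  rewrite /W; under eq_integral do rewrite EFinM -sumEFin.
  rewrite ge0_integralZl_EFin ?sqr_ge0//; last 2 first.
  - by move=> x _; rewrite sume_ge0// => j _; rewrite lee_fin mulr_ge0// addr_ge0// indicE.
  - apply: emeasurable_sum => j; apply/measurable_EFinP; apply: measurable_funM => //.
    by apply: measurable_funD; apply: measurable_indic.
  rewrite ge0_integral_sum//; last first.
    move=> j; apply/measurable_EFinP; apply: measurable_funM => //.
    by apply: measurable_funD; apply: measurable_indic.
  rewrite [leRHS]EFinM -sumEFin lee_wpmul2l// ?lee_fin ?sqr_ge0//; apply: lee_sum => j _.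
  under eq_integral do rewrite EFinM EFinD.
  rewrite ge0_integralZl_EFin//; last 2 first.
  - by move=> x _; rewrite -EFinD lee_fin addr_ge0// indicE.
  - by apply/measurable_EFinP; apply: measurable_funD; apply: measurable_indic.
  rewrite ge0_integralD//; [|by apply/measurable_EFinP; apply: measurable_indic..].
  by rewrite !integral_indic// !setIT EFinM EFinD /G /H -!prE.
have m1 : m <= 1 by exact: pr1.
(* One factor 2 counts the two tails, the other is the bound of [sum_odd_geometric] at
   [q = 1 - m]. *)
have : L ^+ 2 <= (2 * d / m) ^+ 2.
  apply: le_trans key _.
  apply: (@le_trans _ _ (d ^+ 2 * (2 * \sum_(j < J) (2 * j + 1)%:R * (1 - m) ^+ j))).
    rewrite ler_wpM2l ?sqr_ge0// mulr_sumr; apply: ler_sum => j _.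
    rewrite mulrCA ler_wpM2l//; have := Gdec j; have := Hdec j; lra.
  have m01 : 0 <= 1 - m < 1 by apply/andP; split; lra.
  have := sum_odd_geometric J m01; rewrite subKr.
  set s := \sum_(j < J) _ => h.
  have -> : (2 * d / m) ^+ 2 = d ^+ 2 * (2 * (2 / m ^+ 2)) by field; rewrite gt_eqF.
  by rewrite ler_wpM2l ?sqr_ge0// ler_wpM2l// ler_pdivlMr ?exprn_gt0// mulrC.
rewrite ler_pXn2r ?nnegrE ?(ltW L0) ?divr_ge0 ?mulr_ge0 ?(ltW d0) ?(ltW m0)//.
by rewrite !ler_pdivlMr// mulrC.
Qed.
End small_ball.

(** * The Fejer kernel and the characteristic function *)

Section fejer.
Context {R : realType}.
Local Notation mu := (@lebesgue_measure R).
Implicit Types s T u : R.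

(** The primitive comes from integrating [(1 - s / T) * cos (s * u)] by parts. *)
Lemma is_derive_fejer_primitive T u s : T != 0 -> u != 0 ->
  is_derive s 1 (fun s : R => (1 - s / T) * (sin (s * u) / u) - cos (s * u) / (T * u ^+ 2))
    ((1 - s / T) * cos (s * u)).
Proof.
move=> T0 u0.
have d1 : is_derive s 1 (fun s : R => s * u) u.
  by apply: is_derive_eq; rewrite /GRing.scale /=; ring.
have d2 : is_derive s 1 (fun s : R => sin (s * u)) (cos (s * u) * u).
  by have := @is_derive1_comp R _ _ s _ _ (is_derive_sin (s * u)) d1.
have d3 : is_derive s 1 (fun s : R => cos (s * u)) (- sin (s * u) * u).
  by have := @is_derive1_comp R _ _ s _ _ (is_derive_cos (s * u)) d1.
apply: is_derive_eq; rewrite /GRing.scale /=; field.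
by rewrite T0 u0.
Qed.

Lemma continuous_fejer T u : continuous (fun s : R => (1 - s / T) * cos (s * u)).
Proof.
move=> s; apply: cvgM.
  by apply: cvgB; [exact: cvg_cst|apply: cvgM; [exact: cvg_id|exact: cvg_cst]].
apply: continuous_comp; last exact: continuous_cos.
by apply: cvgM; [exact: cvg_id|exact: cvg_cst].
Qed.

Lemma integrable_continuous_itv (f : R -> R) a b :
  continuous f -> mu.-integrable `[a, b] (EFin \o f).
Proof.
by move=> cf; apply: continuous_compact_integrable;
  [exact: segment_compact|exact: continuous_subspaceT].
Qed.

(** Half of the Fourier transform of the triangular function on [-T, T], that is, half of a
    continuous Fejer kernel. *)
Definition fejer T u : R := \int[mu]_(s in `[0%R, T]) ((1 - s / T) * cos (s * u)).

Lemma fejer_le T u : 0 < T -> fejer T u <= T.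
Proof.
move=> T0; apply: (@le_trans _ _ (\int[mu]_(s in `[0%R, T]) 1)).
  apply: le_Rintegral => //.
  - exact/integrable_continuous_itv/continuous_fejer.
  - by apply: integrable_continuous_itv => x; exact: cvg_cst.
  move=> s /=; rewrite in_itv /= => /andP[s0 sT].
  have h0 : 0 <= 1 - s / T by rewrite subr_ge0 ler_pdivrMr// mul1r.
  have h1 : 1 - s / T <= 1 by rewrite gerBl divr_ge0// ltW.
  have := cos_le1 (s * u); nra.
rewrite Rintegral_cst//= lebesgue_measure_itv /= lte_fin T0.
by rewrite sube0 mul1r.
Qed.

Lemma fejerE T u : 0 < T -> u != 0 -> fejer T u = (1 - cos (T * u)) / (T * u ^+ 2).
Proof.
move=> T0 u0; have T1 : T != 0 by rewrite gt_eqF.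
have dF s := is_derive_fejer_primitive s T1 u0.
rewrite /fejer /Rintegral.
rewrite (continuous_FTC2 T0 (continuous_subspaceT (continuous_fejer (T := T) (u := u))) _ _
  (F := fun s : R => (1 - s / T) * (sin (s * u) / u) - cos (s * u) / (T * u ^+ 2))).
- rewrite -EFinB /= !mul0r subr0 mul1r sin0 cos0 divff// subrr; field.
  by rewrite T1 u0.
- have cF s : {for s, continuous
      (fun s : R => (1 - s / T) * (sin (s * u) / u) - cos (s * u) / (T * u ^+ 2))}.
    by apply: differentiable_continuous; apply/derivable1_diffP; case: (dF s).
  split.
  + by move=> x _; case: (dF x).
  + by apply: cvg_at_right_filter; exact: cF.
  + by apply: cvg_at_left_filter; exact: cF.
- by move=> x _; rewrite derive1E; apply: derive_val.
Qed.

(** A dyadic staircase above min(T, 2 / (T u^2)), made of indicators of intervals around 0 so that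
    small ball bounds can be applied to it. When |u| T > 2^N the kernel is at most 2 T / 4^N, and
    the factor 8 = 2 * 4 rewrites this with exponent N + 1. *)
Lemma fejer_dyadic T u (N : nat) : 0 < T ->
  fejer T u <= T * (\sum_(j < N) 8 * 4^-1 ^+ j * (`|u| * T <= 2 ^+ j)%R%:R + 8 * 4^-1 ^+ N).
Proof.
move=> T0; have S0 n : 0 <= \sum_(j < n) 8 * 4^-1 ^+ j * (`|u| * T <= 2 ^+ j)%R%:R :> R.
  by apply: sumr_ge0 => j _; rewrite !mulr_ge0// exprn_ge0.
elim: N => [|N IH].
  apply: le_trans (fejer_le u T0) _.
  by rewrite big_ord0 expr0 add0r mulr1; lra.
have [uN|uN] := leP (`|u| * T) (2 ^+ N).
  apply: le_trans IH _; rewrite ler_wpM2l ?(ltW T0)// big_ord_recr /= uN mulr1.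
  by rewrite -addrA lerD2l lerDl mulr_ge0// exprn_ge0.
have u0 : u != 0.
  by apply: contraTneq uN => ->; rewrite normr0 mul0r -leNgt exprn_ge0.
have q0 : (0 : R) < 4^-1 ^+ N by rewrite exprn_gt0.
have v2 : 4 ^+ N < (u * T) ^+ 2 :> R.
  rewrite -[(u * T) ^+ 2]real_normK ?num_real// normrM (gtr0_norm T0).
  have -> : 4 ^+ N = (2 ^+ N) ^+ 2 :> R by rewrite -!exprM mulnC exprM expr2; congr (_ ^+ _); lra.
  by rewrite ltr_pXn2r ?nnegrE ?exprn_ge0// mulr_ge0// ltW.
rewrite fejerE// ler_pdivrMr; last by rewrite mulr_gt0// exprn_even_gt0.
have c1 : 1 - cos (T * u) <= 2 by have := cos_geN1 (T * u); lra.
apply: le_trans c1 _.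
have e4 : 4^-1 ^+ N * 4 ^+ N = 1 :> R by rewrite -exprMn mulVf// expr1n.
apply: (@le_trans _ _ (T * (8 * 4^-1 ^+ N.+1) * (T * u ^+ 2))); last first.
  apply: ler_wpM2r; first by rewrite mulr_ge0 ?sqr_ge0 ?(ltW T0).
  by apply: ler_wpM2l; rewrite ?(ltW T0) ?lerDr ?S0.
have -> : T * (8 * 4^-1 ^+ N.+1) * (T * u ^+ 2) = 2 * (4^-1 ^+ N * (u * T) ^+ 2).
  by rewrite exprS; field.
have : 4^-1 ^+ N * 4 ^+ N <= 4^-1 ^+ N * (u * T) ^+ 2 :> R by rewrite ler_wpM2l// ltW.
by rewrite e4; lra.
Qed.
End fejer.

(** * Fubini for bounded functions on a strip *)

Section fubini_bounded.
Context {R : realType} (P : probability (measurableTypeR R) R).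
Local Notation mu := (@lebesgue_measure R).
Variables (F : measurableTypeR R -> measurableTypeR R -> R) (T B : R).
Hypothesis mF : measurable_fun setT (fun z : measurableTypeR R * measurableTypeR R => F z.1 z.2).
Let I : set (measurableTypeR R) := `[0, T]%classic.
Hypothesis FB : forall x s, I s -> `|F x s| <= B.

Let mI : measurable I. Proof. exact: measurable_itv. Qed.

Let Iy : (mu I < +oo)%E.
Proof. by rewrite lebesgue_measure_itv /=; case: ifPn => _; rewrite ?ltry// -EFinB ltry. Qed.

Let D : set (measurableTypeR R * measurableTypeR R) := setT `*` I.

(** Extension by zero outside the strip lets Fubini run on the whole product; the iterated integrals
    are then cut back to [I]. *)
Let f := (EFin \o (fun z => F z.1 z.2)) \_ D.

Let mD : measurable D. Proof. exact: measurableX. Qed.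

Let integrable_f : (P \x mu)%E.-integrable setT f.
Proof.
apply/integrable_restrict => //; rewrite setTI.
apply: measurable_bounded_integrable => //.
- have := product_measure1E P mu measurableT mI; rewrite /= -/D => ->.
  by rewrite probability_setT mul1e.
- exact: measurable_funTS.
- exists B; split; first exact: num_real.
  by move=> c Bc -[x s] /= [_ Is]; apply: le_trans (FB x Is) (ltW Bc).
Qed.

Let measurable_Fx x : measurable_fun setT (F x).
Proof. exact: (measurableT_comp mF (measurable_pair1 x)). Qed.

Let measurable_Fs s : measurable_fun setT (F^~ s).
Proof. exact: (measurableT_comp mF (measurable_pair2 s)). Qed.

Let integrable_Fx x : mu.-integrable I (EFin \o F x).
Proof.
apply: measurable_bounded_integrable => //; first exact: measurable_funTS.
exists B; split; first exact: num_real.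
by move=> c Bc s /= Is; apply: le_trans (FB x Is) (ltW Bc).
Qed.

Let integrable_Fs s : I s -> P.-integrable setT (EFin \o F^~ s).
Proof.
move=> Is; apply: measurable_bounded_integrable => //.
  by rewrite (le_lt_trans (probability_le1 _ _)) ?ltry.
exists B; split; first exact: num_real.
by move=> c Bc x /= _; apply: le_trans (FB x Is) (ltW Bc).
Qed.

Let fxE x : (\int[mu]_s f (x, s) = (\int[mu]_(s in I) F x s)%:E)%E.
Proof.
rewrite /Rintegral fineK; last exact: (integrable_fin_num mI (integrable_Fx x)).
rewrite [RHS]integral_mkcond; apply: eq_integral => s _.
rewrite /f /patch /D; case: (boolP (s \in I)) => sI.
  by rewrite mem_set//; split => //; exact: set_mem.
by rewrite memNset// => -[_ /= Is]; move/negP: sI; apply; rewrite inE.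
Qed.

Let fsE s : (\int[P]_x f (x, s) = ((EFin \o (fun s => \int[P]_x F x s)%R) \_ I) s)%E.
Proof.
rewrite /patch; case: ifPn => sI.
  rewrite /= /Rintegral fineK; last first.
    by apply: (integrable_fin_num measurableT (integrable_Fs _)); exact: set_mem.
  apply: eq_integral => x _; rewrite /f /patch mem_set//; split => //.
  by exact: set_mem.
rewrite integral0_eq// => x _; rewrite /f /patch memNset// => -[_ /= Is].
by move/negP: sI; apply; rewrite inE.
Qed.

Lemma integrable_Rintegral_itv :
  P.-integrable setT (EFin \o (fun x => \int[mu]_(s in I) F x s)).
Proof.
have := integrable_fubini_F integrable_f.
by apply: eq_integrable => // x _; rewrite /fubini_F fxE.
Qed.

Lemma Rintegral_fubini_itv :
  \int[mu]_(s in I) (\int[P]_x F x s) = \int[P]_x (\int[mu]_(s in I) F x s).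
Proof.
have e1 : (\int[P]_x fubini_F mu f x = \int[P]_x (\int[mu]_(s in I) F x s)%R%:E)%E.
  by apply: eq_integral => x _; exact: fxE.
have e2 : (\int[mu]_s fubini_G P f s = \int[mu]_(s in I) (\int[P]_x F x s)%R%:E)%E.
  by rewrite [RHS]integral_mkcond; apply: eq_integral => s _; exact: fsE.
by rewrite [LHS]/Rintegral [RHS]/Rintegral -e1 -e2 (Fubini integrable_f).
Qed.
End fubini_bounded.

(** * Square integrability of the characteristic function from small ball bounds *)

Section characteristic_function.
Context {R : realType} (P : probability (measurableTypeR R) R) (L : R).
Local Notation mu := (@lebesgue_measure R).
Hypothesis L0 : 0 < L.
Hypothesis sb : forall a d : R, 0 < d -> fine (P `[a, a + d[%classic) <= 2 * d / L.

Let A s := \int[P]_x cos (s * x).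
Let B s := \int[P]_x sin (s * x).

(* |phi(s)|^2 for the characteristic function phi of [P]. *)
Definition charfun_sqr s := A s ^+ 2 + B s ^+ 2.

Let intP (f : measurableTypeR R -> R) (c : R) : measurable_fun setT f ->
  (forall x, `|f x| <= c) -> P.-integrable setT (EFin \o f).
Proof.
move=> mf fc; apply: measurable_bounded_integrable => //.
  by rewrite (le_lt_trans (probability_le1 _ _)) ?ltry.
exists c; split; first exact: num_real.
by move=> e ce x /= _; apply: le_trans (fc x) (ltW ce).
Qed.

Let Rint_cst (c : R) : \int[P]_x c = c.
Proof.
rewrite Rintegral_cst//; have /= -> : fine (P setT) = 1 by rewrite probability_setT.
by rewrite mulr1.
Qed.

Let mcos : measurable_fun setT (cos : measurableTypeR R -> R).
Proof. by apply: continuous_measurable_fun; exact: continuous_cos. Qed.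

Let msin : measurable_fun setT (sin : measurableTypeR R -> R).
Proof. by apply: continuous_measurable_fun; exact: continuous_sin. Qed.

Let cos_bd (x : R) : `|cos x| <= 1.
Proof. by rewrite ler_norml cos_geN1 cos_le1. Qed.

Let sin_bd (x : R) : `|sin x| <= 1.
Proof. by rewrite ler_norml sin_geN1 sin_le1. Qed.

Let icos s : P.-integrable setT (EFin \o (fun x => cos (s * x))).
Proof. by apply: (@intP _ 1) => //; exact: measurableT_comp. Qed.

Let isin s : P.-integrable setT (EFin \o (fun x => sin (s * x))).
Proof. by apply: (@intP _ 1) => //; exact: measurableT_comp. Qed.

Let avg_bd (f : measurableTypeR R -> R) : measurable_fun setT f ->
  (forall x, `|f x| <= 1) -> `|\int[P]_x f x| <= 1.
Proof.
move=> mf f1; have fi := intP mf f1.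
apply: le_trans (le_normr_Rintegral measurableT fi) _.
apply: (@le_trans _ _ (\int[P]_x 1)).
  apply: le_Rintegral => //.
    apply: (@intP _ 1); first exact: measurableT_comp.
    by move=> x; rewrite normr_id.
  by apply: (@intP _ 1) => // x; rewrite normr1.
by rewrite Rint_cst.
Qed.

Let A1 s : `|A s| <= 1.
Proof. by apply: avg_bd => //; exact: measurableT_comp. Qed.

Let B1 s : `|B s| <= 1.
Proof. by apply: avg_bd => //; exact: measurableT_comp. Qed.

(** Adding 1 makes the integrand non-negative, so that measurability follows from the Tonelli
    setting; the constant is subtracted afterwards. *)
Let measurable_avg (g : measurableTypeR R -> R) : measurable_fun setT g ->
  (forall x, `|g x| <= 1) ->
  measurable_fun setT (fun s : measurableTypeR R => \int[P]_x g (s * x)).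
Proof.
move=> mg g1.
have mg2 : measurable_fun setT
    (fun z : measurableTypeR R * measurableTypeR R => g (z.2 * z.1)).
  apply: (measurableT_comp mg); apply: measurable_funM.
    exact: measurable_snd.
  exact: measurable_fst.
have h0 (z : measurableTypeR R * measurableTypeR R) : (0 <= (g (z.2 * z.1) + 1)%:E)%E.
  by rewrite lee_fin; have := g1 (z.2 * z.1); rewrite ler_norml => /andP[]; lra.
have mh : measurable_fun setT
    (fun z : measurableTypeR R * measurableTypeR R => (g (z.2 * z.1) + 1)%:E).
  by apply/measurable_EFinP; apply: measurable_funD.
have := @measurable_fun_fubini_tonelli_G _ _ _ _ R P _ mh h0.
rewrite /fubini_G /= => mG.
have mG' := measurable_funB (measurableT_comp (fine_measurable measurableT) mG)
  (@measurable_cst _ _ _ _ setT (1 : R)).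
apply: eq_measurable_fun mG' => s _ /=.
have gi : P.-integrable setT (EFin \o (fun x : measurableTypeR R => g (s * x))).
  by apply: (@intP _ 1) => //; exact: measurableT_comp.
have i1 : P.-integrable setT (EFin \o (fun x : measurableTypeR R => 1 : R)).
  by apply: (@intP _ 1) => // x; rewrite normr1.
have := RintegralD measurableT gi i1.
rewrite Rint_cst /Rintegral => ->.
by rewrite addrK.
Qed.

Let mA : measurable_fun setT (A : measurableTypeR R -> R).
Proof. exact: measurable_avg. Qed.

Let mB : measurable_fun setT (B : measurableTypeR R -> R).
Proof. exact: measurable_avg. Qed.

Lemma measurable_charfun_sqr : measurable_fun setT (charfun_sqr : measurableTypeR R -> R).
Proof. by apply: measurable_funD; exact: measurable_funX. Qed.

Lemma charfun_sqr_ge0 s : 0 <= charfun_sqr s.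
Proof. by rewrite addr_ge0 ?sqr_ge0. Qed.

(** Bounding the cosine and sine averages separately gives 2 in place of the sharp value 1, at the
    price of a slightly larger final constant. *)
Lemma charfun_sqr_le2 s : charfun_sqr s <= 2.
Proof.
have aux (a : R) : `|a| <= 1 -> a ^+ 2 <= 1.
  by move=> a1; rewrite -[a ^+ 2]real_normK ?num_real// expr_le1.
by have := aux _ (A1 s); have := aux _ (B1 s); rewrite /charfun_sqr; lra.
Qed.

Let weight T (s : measurableTypeR R) : R := 1 - s / T.

Let mweight T : measurable_fun setT (weight T).
Proof. by apply: measurable_funB => //; exact: measurable_funM. Qed.

Let weight1 T s : 0 < T -> `[0, T]%classic s -> `|weight T s| <= 1.
Proof.
move=> T0; rewrite /= in_itv /= => /andP[s0 sT].
have h0 : 0 <= 1 - s / T by rewrite subr_ge0 ler_pdivrMr// mul1r.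
by rewrite ger0_norm// gerBl divr_ge0// ltW.
Qed.

Let step_integral N (c : nat -> R) (E : nat -> set (measurableTypeR R)) :
  (forall j, measurable (E j)) ->
  P.-integrable setT (EFin \o (fun y => \sum_(j < N) c j * \1_(E j) y)) /\
  \int[P]_y (\sum_(j < N) c j * \1_(E j) y) = \sum_(j < N) c j * fine (P (E j)).
Proof.
move=> mE; elim: N => [|N [iN IH]].
  split; last by under eq_Rintegral do rewrite big_ord0; rewrite Rint_cst big_ord0.
  rewrite (_ : (fun _ => _) = cst 0); last by apply/funext => y; rewrite big_ord0.
  by apply: (@intP _ 0) => // x; rewrite normr0.
have iE : P.-integrable setT (EFin \o \1_(E N)).
  by apply: (@intP _ 1) => // x; rewrite indicE normr_nat; case: (_ \in _).
have icE : P.-integrable setT (EFin \o (fun y => c N * \1_(E N) y)).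
  apply: (@intP _ `|c N|) => [|x]; first exact: measurable_funM.
  by rewrite normrM ler_piMr// indicE normr_nat; case: (_ \in _).
have eN y : \sum_(j < N.+1) c j * \1_(E j) y =
    \sum_(j < N) c j * \1_(E j) y + c N * \1_(E N) y by rewrite big_ord_recr.
split.
  by under eq_fun do rewrite eN; exact: (integrableD measurableT iN icE).
under eq_Rintegral do rewrite eN.
rewrite RintegralD// IH big_ord_recr /= RintegralZl//.
by rewrite /Rintegral integral_indic// setIT.
Qed.

Let integrable_fejer T x : 0 < T -> P.-integrable setT (EFin \o (fun y => fejer T (y - x))) /\
  \int[P]_y fejer T (y - x) =
  \int[mu]_(s in `[0%R, T]) (\int[P]_y (weight T s * cos (s * (y - x)))).
Proof.
move=> T0; pose F (y s : measurableTypeR R) := weight T s * cos (s * (y - x)).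
have mF : measurable_fun setT (fun z : measurableTypeR R * measurableTypeR R => F z.1 z.2).
  apply: measurable_funM; first exact: (measurableT_comp (mweight T) measurable_snd).
  apply: (measurableT_comp mcos); apply: measurable_funM; first exact: measurable_snd.
  by apply: measurable_funB => //; exact: measurable_fst.
have FB y s : `[0, T]%classic s -> `|F y s| <= 1.
  by move=> sT; rewrite normrM mulr_ile1// weight1.
split; first exact: (integrable_Rintegral_itv P mF FB).
by rewrite (Rintegral_fubini_itv P mF FB).
Qed.

(** At scale j the staircase has height 8 T / 4^j on a set of probability at most 6 * 2^j / (T L),
    which contributes 48 * 2^-j / L. The scales add up to at most 96 / L and the remainder gives 8 /
    L. *)
Lemma integral_fejer_le T x : 0 < T -> \int[P]_y fejer T (y - x) <= 104 / L.
Proof.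
move=> T0; have TL : 0 < T * L by rewrite mulr_gt0.
pose N := (Num.truncn (T * L)).+1.
(* [T * L < N < 4 ^ N] by the choice of [N]. *)
have TN : T * 4^-1 ^+ N <= 1 / L.
  rewrite exprVn ler_pdivrMr ?exprn_gt0// mulrAC ler_pdivlMr// mul1r ltW//.
  apply: (@lt_le_trans _ _ N%:R); first exact: truncnS_gt.
  by rewrite -natrX ler_nat ltnW// ltn_expl.
pose E (j : nat) := [set y : measurableTypeR R | `|y - x| * T <= 2 ^+ j].
have mE j : measurable (E j).
  apply: measurable_le_set => //; apply: measurable_funM => //.
  by apply: measurableT_comp => //; exact: measurable_funB.
have PE j : fine (P (E j)) <= 6 * 2 ^+ j / (T * L).
  (* [E j] is a closed interval of length [2 * r]; the half-open interval of length [3 * r] with the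
     same left end contains it, whence the 6. *)
  pose r := 2 ^+ j / T; have r0 : 0 < r by rewrite divr_gt0// exprn_gt0.
  apply: (@le_trans _ _ (2 * (3 * r) / L)); last first.
    by rewrite /r le_eqVlt; apply/orP; left; apply/eqP; field; rewrite !gt_eqF.
  have r30 : 0 < 3 * r by rewrite mulr_gt0.
  apply: le_trans (sb (x - r) r30).
  rewrite fine_le ?fin_num_measure// le_measure ?inE// => y.
  rewrite /E /= -ler_pdivlMr// -/r ler_norml in_itv /= => /andP[? ?].
  by apply/andP; split; lra.
pose c (j : nat) := T * (8 * 4^-1 ^+ j) : R.
have [iS eS] := step_integral N c mE.
have iC : P.-integrable setT (EFin \o (fun y : measurableTypeR R => T * (8 * 4^-1 ^+ N))).
  by apply: (@intP _ `|T * (8 * 4^-1 ^+ N)|).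
apply: (@le_trans _ _ (\int[P]_y (\sum_(j < N) c j * \1_(E j) y + T * (8 * 4^-1 ^+ N)))).
  apply: le_Rintegral => //.
  - by case: (integrable_fejer x T0).
  - exact: (integrableD measurableT iS iC).
  move=> y _; apply: le_trans (fejer_dyadic (y - x) N T0) _.
  rewrite mulrDr lerD2r mulr_sumr; apply: ler_sum => j _.
  by rewrite mulrA indicE /E mem_setE.
rewrite RintegralD// eS Rint_cst.
have h1 : \sum_(j < N) c j * fine (P (E j)) <= 48 / L * \sum_(j < N) 2^-1 ^+ j.
  rewrite mulr_sumr; apply: ler_sum => j _.
  apply: le_trans (ler_wpM2l _ (PE j)) _; first by rewrite !mulr_ge0 ?exprn_ge0// ltW.
  have -> : c j = T * (8 * (2^-1 ^+ j * 2^-1 ^+ j)).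
    by rewrite /c -exprMn; congr (_ * (_ * _ ^+ _)); lra.
  have -> : 2 ^+ j = (2^-1 ^+ j)^-1 :> R by rewrite exprVn invrK.
  rewrite le_eqVlt; apply/orP; left; apply/eqP.
  by field; rewrite ?gt_eqF ?exprn_gt0.
have h2 : \sum_(j < N) 2^-1 ^+ j <= 2 :> R.
  have -> : \sum_(j < N) 2^-1 ^+ j = 2 - 2 * 2^-1 ^+ N :> R.
    elim: N {TN iS eS iC h1} => [|n IH]; first by rewrite big_ord0 expr0; lra.
    by rewrite big_ord_recr /= IH exprS; lra.
  by rewrite gerBl mulr_ge0// exprn_ge0.
have h3 : 48 / L * \sum_(j < N) 2^-1 ^+ j <= 48 / L * 2.
  by rewrite ler_wpM2l// divr_ge0// ltW.
by move: TN h1 h3; rewrite mulrCA; lra.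
Qed.

(** Averaging [F] over x gives back the weighted |phi|^2. For fixed x,
    [A s * cos (s * x) + B s * sin (s * x)] is the mean over y of cos(s (y - x)), so after Fubini
    the integral over s becomes a mean of [fejer T (y - x)], whose bound is uniform in x. *)
Lemma weighted_charfun_sqr_le T : 0 < T ->
  \int[mu]_(s in `[0%R, T]) ((1 - s / T) * charfun_sqr s) <= 104 / L.
Proof.
move=> T0.
pose F (x s : measurableTypeR R) := weight T s * (A s * cos (s * x) + B s * sin (s * x)).
have m21 : measurable_fun setT (fun z : measurableTypeR R * measurableTypeR R => z.2 * z.1).
  by apply: measurable_funM; [exact: measurable_snd|exact: measurable_fst].
have mF : measurable_fun setT (fun z : measurableTypeR R * measurableTypeR R => F z.1 z.2).
  apply: measurable_funM; first exact: (measurableT_comp (mweight T) measurable_snd).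
  apply: measurable_funD; apply: measurable_funM.
  - exact: (measurableT_comp mA measurable_snd).
  - exact: (measurableT_comp mcos m21).
  - exact: (measurableT_comp mB measurable_snd).
  - exact: (measurableT_comp msin m21).
have FB x s : `[0, T]%classic s -> `|F x s| <= 1 + 1.
  move=> sT; rewrite normrM -[leRHS]mul1r ler_pM// ?weight1//.
  by apply: le_trans (ler_normD _ _) _; rewrite lerD// normrM mulr_ile1.
have -> : \int[mu]_(s in `[0%R, T]) ((1 - s / T) * charfun_sqr s) =
    \int[mu]_(s in `[0%R, T]) (\int[P]_x F x s).
  apply: eq_Rintegral => s _; rewrite /F.
  have i1 : P.-integrable setT (EFin \o (fun x => A s * cos (s * x))).
    exact: (integrableZl measurableT _ (icos s)).
  have i2 : P.-integrable setT (EFin \o (fun x => B s * sin (s * x))).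
    exact: (integrableZl measurableT _ (isin s)).
  rewrite RintegralZl//; last exact: (integrableD measurableT i1 i2).
  by rewrite RintegralD// !RintegralZl.
rewrite (Rintegral_fubini_itv P mF FB).
apply: (@le_trans _ _ (\int[P]_x (104 / L))); last by rewrite Rint_cst.
apply: le_Rintegral => //.
- exact: (integrable_Rintegral_itv P mF FB).
- exact: (@intP _ `|104 / L|).
move=> x _; apply: le_trans (integral_fejer_le x T0).
have [_ ->] := integrable_fejer x T0.
rewrite le_eqVlt; apply/orP; left; apply/eqP; apply: eq_Rintegral => s _; rewrite /F.
rewrite RintegralZl//; last first.
  apply: (@intP _ 1) => //; apply: (measurableT_comp mcos); apply: measurable_funM => //.
  exact: measurable_funB.
congr (_ * _).
have i1 : P.-integrable setT (EFin \o (fun y => cos (s * x) * cos (s * y))).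
  exact: (integrableZl measurableT _ (icos s)).
have i2 : P.-integrable setT (EFin \o (fun y => sin (s * x) * sin (s * y))).
  exact: (integrableZl measurableT _ (isin s)).
rewrite [LHS](_ : _ = cos (s * x) * A s + sin (s * x) * B s); last by ring.
rewrite -!RintegralZl// -RintegralD//; apply: eq_Rintegral => y _.
by rewrite mulrBr cosB; ring.
Qed.

(** On [0, T] the weight belonging to 2 T is at least 1/2, hence 208 = 2 * 104; the bound does not
    depend on T and passes to the monotone limit. *)
Lemma charfun_sqr_integral_le :
  (\int[mu]_(s in `[0%R, +oo[) (charfun_sqr s)%:E <= (208 / L)%:E)%E.
Proof.
pose I (n : nat) : set (measurableTypeR R) := `[0, n.+1%:R]%classic.
have UI : \bigcup_n I n = `[0%R, +oo[%classic.
  apply/seteqP; split => x /=.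
    by move=> [n _]; rewrite /I /= !in_itv /= andbT => /andP[].
  rewrite in_itv /= andbT => x0; exists (Num.truncn x) => //.
  by rewrite /I /= in_itv /= x0 ltW// truncnS_gt.
have mphi := measurable_charfun_sqr.
have mI n : measurable (I n) by exact: measurable_itv.
have mE D : measurable_fun D (fun s : measurableTypeR R => (charfun_sqr s)%:E).
  by apply/measurable_EFinP; exact: measurable_funTS.
have ndI : nondecreasing_seq I.
  move=> m n mn; apply/subsetPset => x; rewrite /I /= !in_itv /= => /andP[-> xm] /=.
  by apply: le_trans xm _; rewrite ler_nat.
have := @ge0_nondecreasing_set_cvg_integral _ _ _ I
  (fun s : measurableTypeR R => (charfun_sqr s)%:E) mu ndI mI (fun i => mE _)
  (fun i s _ => charfun_sqr_ge0 s).
rewrite UI => cvgI; rewrite -(cvg_lim _ cvgI)//.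
apply: lime_le; first by apply/cvg_ex; eexists; exact: cvgI.
apply: nearW => n; pose T := n.+1%:R : R.
have T0 : 0 < T by rewrite /T ltr0n.
have T20 : 0 < 2 * T by rewrite mulr_gt0.
pose W (s : measurableTypeR R) := weight (2 * T) s * charfun_sqr s.
have mW : measurable_fun setT W by exact: measurable_funM.
have W0 s : `[0, 2 * T]%classic s -> 0 <= W s.
  rewrite /= in_itv /= => /andP[s0 sT]; rewrite mulr_ge0 ?charfun_sqr_ge0//.
  by rewrite subr_ge0 ler_pdivrMr// mul1r.
apply: (@le_trans _ _ (\int[mu]_(s in I n) (2 * W s)%:E)%E).
  apply: ge0_le_integral => //.
  - by move=> s _; rewrite lee_fin charfun_sqr_ge0.
  - by apply/measurable_EFinP; apply: measurable_funTS; exact: measurable_funM.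
  move=> s; rewrite /I /= in_itv /= => /andP[s0 sT]; rewrite lee_fin mulrA.
  rewrite ler_peMl ?charfun_sqr_ge0// /weight.
  have : s / (2 * T) <= 1 / 2 by rewrite ler_pdivrMr// -/T in sT *; lra.
  by move: (s / (2 * T)) => z; lra.
apply: (@le_trans _ _ (\int[mu]_(s in `[0%R, (2 * T)%R]) (2 * W s)%:E)%E).
  apply: ge0_subset_integral => //.
  - by apply/measurable_EFinP; apply: measurable_funTS; exact: measurable_funM.
  - by move=> s /W0 ?; rewrite lee_fin mulr_ge0.
  move=> s; rewrite /I /= !in_itv /= => /andP[-> sT] /=; apply: le_trans sT _; rewrite -/T.
  by lra.
have iW : mu.-integrable `[0, 2 * T]%classic (EFin \o W).
  apply: measurable_bounded_integrable => //.
  - by rewrite [ltLHS]lebesgue_measure_itv /= lte_fin T20 -EFinB ltry.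
  - exact: measurable_funTS.
  exists 2; split; first exact: num_real.
  move=> c c2 s sT; apply: le_trans (ltW c2); rewrite normrM -[leRHS]mul1r.
  by rewrite ler_pM ?weight1// ger0_norm ?charfun_sqr_ge0// charfun_sqr_le2.
have := weighted_charfun_sqr_le T20.
rewrite -lee_fin /Rintegral fineK; last exact: (integrable_fin_num _ iW).
move=> h; under eq_integral do rewrite EFinM.
rewrite integralZl//.
apply: le_trans (lee_wpmul2l _ h) _ => //.
by rewrite -EFinM lee_fin; lra.
Qed.

End characteristic_function.

(** * Mean bodies *)

Section cos_lower_bound.
Context {R : realType}.
Implicit Types x : R.

Lemma sin_sqr_le x : sin x ^+ 2 <= x ^+ 2.
Proof.
wlog x0 : x / 0 < x.
  move=> h; have [x0|x0|<-] := ltgtP 0 x; last by rewrite sin0.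
    exact: h.
  by have := h (- x); rewrite sinN !sqrrN oppr_gt0; apply.
have [c _] : exists2 c, c \in `]0, x[ & sin x - sin 0 = cos c * (x - 0).
  apply: MVT => //.
  by apply: continuous_subspaceT => y; exact: continuous_sin.
by rewrite sin0 !subr0 => ->; rewrite exprMn ler_piMl ?sqr_ge0//.
Qed.

(** Half-angle formula: cos x = 1 - 2 sin(x / 2)^2. *)
Lemma cos_ge_sqr x : 1 - x ^+ 2 / 2 <= cos x.
Proof.
have -> : cos x = cos ((x / 2) *+ 2) by rewrite -mulr_natr divfK.
rewrite cos_mulr2n; have := sin_sqr_le (x / 2); have := cos2Dsin2 (x / 2).
rewrite expr_div_n -mulr_natr; lra.
Qed.
End cos_lower_bound.

(** * Mellin-type integrals *)

Section powR_integral.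
Context {R : realType}.
Local Notation mu := (@lebesgue_measure R).
Variable p : R.
Hypothesis p0 : 0 < p.

Lemma integral_powR_itv (a b : R) : 0 < a -> a < b ->
  (\int[mu]_(r in `[a, b]) (p * r `^ (p - 1))%:E = (b `^ p - a `^ p)%:E)%E.
Proof.
move=> a0 ab.
have pos (x : R) : a <= x -> x \in `]0, +oo[.
  by move=> ax; rewrite in_itv /= andbT (lt_le_trans a0).
have cpow (q x : R) : a <= x -> {for x, continuous (fun y : R => y `^ q)}.
  move=> ax; apply: differentiable_continuous; apply/derivable1_diffP.
  by apply: derivable_powR; exact: pos.
rewrite (continuous_FTC2 ab (F := fun y : R => y `^ p)) ?EFinB//.
- apply: continuous_in_subspaceT => x; rewrite inE /= in_itv /= => /andP[ax _].
  by apply: cvgM; [exact: cvg_cst|exact: cpow].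
- split.
  + by move=> x; rewrite in_itv /= => /andP[ax _]; apply: derivable_powR; apply: pos; exact: ltW.
  + by apply: cvg_at_right_filter; exact: cpow.
  + by apply: cvg_at_left_filter; apply: cpow; exact: ltW.
- by move=> x; rewrite in_itv /= => /andP[ax _]; rewrite powR_derive1// pos// ltW.
Qed.

Let mp D : measurable_fun D (fun r : measurableTypeR R => (p * r `^ (p - 1))%:E).
Proof.
apply/measurable_EFinP; apply: measurable_funTS; exact: measurable_funM.
Qed.

Let p_ge0 r : 0 <= p * r `^ (p - 1).
Proof. by rewrite mulr_ge0 ?powR_ge0// ltW. Qed.

Lemma integral_powR_le (b : R) : 0 < b ->
  (\int[mu]_(r in `]0%R, b]) (p * r `^ (p - 1))%:E <= (b `^ p)%:E)%E.
Proof.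
(* The exhaustion stays away from 0, where the integrand is singular for [p < 1]; starting at [n.+2]
   keeps every left end strictly below [b]. *)
move=> b0; pose I (n : nat) : set (measurableTypeR R) := `[b / n.+2%:R, b]%classic.
have UI : \bigcup_n I n = `]0, b]%classic.
  apply/seteqP; split => x /=.
    move=> [n _]; rewrite /I /= !in_itv /= => /andP[h ->]; rewrite andbT.
    by apply: lt_le_trans h; rewrite divr_gt0.
  rewrite in_itv /= => /andP[x0 xb]; exists (Num.truncn (b / x)) => //.
  rewrite /I /= in_itv /= xb andbT ler_pdivrMr// mulrC -ler_pdivrMr//.
  by rewrite ltW// (lt_le_trans (truncnS_gt _))// ler_nat.
have mI n : measurable (I n) by exact: measurable_itv.
have ndI : nondecreasing_seq I.
  move=> m n mn; apply/subsetPset => x; rewrite /I /= !in_itv /= => /andP[h ->].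
  by rewrite andbT; apply: le_trans h; rewrite ler_wpM2l ?(ltW b0)// lef_pV2 ?posrE// ler_nat.
have := @ge0_nondecreasing_set_cvg_integral _ _ _ I
  (fun r : measurableTypeR R => (p * r `^ (p - 1))%:E) mu ndI mI (fun i => @mp (I i))
  (fun i s _ => p_ge0 s).
rewrite UI => cvgI; rewrite -(cvg_lim _ cvgI)//.
apply: lime_le; first by apply/cvg_ex; eexists; exact: cvgI.
apply: nearW => n; rewrite integral_powR_itv ?divr_gt0//.
  by rewrite lee_fin gerBl powR_ge0.
by rewrite ltr_pdivrMr// ltr_pMr// ltr1n.
Qed.

Lemma mellin_bounds (phi : measurableTypeR R -> R) (L c : R) : p <= 1 -> 0 < L ->
  measurable_fun setT phi -> (forall s, 0 <= phi s <= 2) ->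
  (forall s, 0 <= s <= L^-1 -> 4^-1 <= phi s) ->
  (\int[mu]_(s in `[0%R, +oo[) (phi s)%:E <= (c / L)%:E)%E ->
  ((8^-1 * L^-1 `^ p)%:E <= p%:E * \int[mu]_(r in `]0%R, +oo[) (phi r * r `^ (p - 1))%:E
     <= ((c + 2) * L^-1 `^ p)%:E)%E.
Proof.
move=> p1 L0 mphi phi2 phi4 phic; set l := L^-1.
have l0 : 0 < l by rewrite invr_gt0.
pose f (r : measurableTypeR R) := phi r * (p * r `^ (p - 1)).
have f0 r : 0 <= f r by rewrite mulr_ge0//; have /andP[] := phi2 r.
have mf D : measurable_fun D (EFin \o f).
  apply/measurable_EFinP; apply: measurable_funTS; apply: measurable_funM => //.
  by exact: measurable_funM.
have -> : (p%:E * \int[mu]_(r in `]0%R, +oo[) (phi r * r `^ (p - 1))%:E =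
    \int[mu]_(r in `]0%R, +oo[) (f r)%:E)%E.
  rewrite -ge0_integralZl_EFin ?(ltW p0)//.
  - by apply: eq_integral => r _; rewrite -EFinM /f mulrCA.
  - by move=> r _; rewrite lee_fin mulr_ge0 ?powR_ge0//; have /andP[] := phi2 r.
  - apply/measurable_EFinP; apply: measurable_funTS; exact: measurable_funM.
apply/andP; split.
  (* Chosen so that the p-th power of [e] is half that of [l]: the interval [[e, l]] avoids 0 and
     still carries half of the integral over []0, l]], whence 8^-1 = 4^-1 * 2^-1. *)
  pose e := l * 2^-1 `^ p^-1.
  have e0 : 0 < e by rewrite mulr_gt0// powR_gt0.
  have ep : e `^ p = l `^ p / 2.
    rewrite /e powRM ?(ltW l0) ?powR_ge0// -powRrM mulVf ?gt_eqF// powRr1//.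
  have lp0 : 0 < l `^ p by exact: powR_gt0.
  have el : e < l.
    rewrite ltNge; apply/negP => le; have := ge0_ler_powR (ltW p0) _ _ le.
    rewrite !nnegrE (ltW l0) (ltW e0) ep => /(_ isT isT); lra.
  have := integral_powR_itv e0 el; rewrite ep => he.
  apply: (@le_trans _ _ (\int[mu]_(r in `[e, l]) (f r)%:E)%E); last first.
    apply: ge0_subset_integral => //; first by move=> r _; rewrite lee_fin.
    move=> r /=; rewrite !in_itv /= andbT => /andP[er _]; exact: lt_le_trans er.
  apply: (@le_trans _ _ (\int[mu]_(r in `[e, l]) (4^-1%:E * (p * r `^ (p - 1))%:E))%E).
    rewrite ge0_integralZl_EFin//; last by move=> r _; rewrite lee_fin.
    by rewrite he -EFinM lee_fin; lra.
  apply: ge0_le_integral => //.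
  - by move=> r _; rewrite -EFinM lee_fin mulr_ge0.
  - by apply: measurable_funeM; exact: mp.
  move=> r /=; rewrite in_itv /= => /andP[er rl]; rewrite -EFinM lee_fin ler_wpM2r//.
  by apply: phi4; rewrite (le_trans (ltW e0) er).
have -> : `]0, +oo[%classic = `]0, l]%classic `|` `]l, +oo[%classic :> set R.
  apply/seteqP; split => r /=; rewrite !in_itv /= !andbT.
    by move=> ->; case: (leP r l) => _; [left|right].
  by case=> [/andP[]//|]; exact: lt_trans.
rewrite ge0_integral_setU//; last 2 first.
- by move=> r _; rewrite lee_fin.
- apply/disj_setPS => r /= []; rewrite !in_itv /= andbT => /andP[_ rl].
  by rewrite ltNge rl.
rewrite (addrC c) mulrDl EFinD; apply: leeD.
  apply: (@le_trans _ _ (\int[mu]_(r in `]0%R, l]) (2%:E * (p * r `^ (p - 1))%:E))%E).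
    apply: ge0_le_integral => //.
    - by move=> r _; rewrite lee_fin.
    - by apply: measurable_funeM; exact: mp.
    move=> r _; rewrite -EFinM lee_fin ler_wpM2r//; by have /andP[] := phi2 r.
  rewrite ge0_integralZl_EFin//; last by move=> r _; rewrite lee_fin.
  by rewrite EFinM lee_wpmul2l//; exact: integral_powR_le.
have lp1 : l `^ p = l * l `^ (p - 1) by rewrite mulr_powRB1 ?ltW.
apply: (@le_trans _ _ (\int[mu]_(r in `]l, +oo[) ((l `^ (p - 1))%:E * (phi r)%:E))%E).
  apply: ge0_le_integral => //.
  - by move=> r _; rewrite lee_fin.
  - by apply: measurable_funeM; apply/measurable_EFinP; exact: measurable_funTS.
  move=> r /=; rewrite in_itv /= andbT => lr; rewrite -EFinM lee_fin /f mulrC.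
  have /andP[h0 _] := phi2 r; rewrite ler_wpM2r//.
  (* Here [p <= 1] makes the exponent non-positive; just below it also absorbs the factor [p]. *)
  have h1 : r `^ (p - 1) <= l `^ (p - 1).
    rewrite -[p - 1]opprK opprB !powRN lef_pV2 ?posrE ?powR_gt0 ?(lt_trans l0 lr)//.
    apply: ge0_ler_powR; rewrite ?nnegrE ?subr_ge0 ?(ltW l0) ?(ltW lr)//.
    by rewrite ltW// (lt_trans l0 lr).
  by apply: le_trans h1; rewrite ler_piMl ?powR_ge0.
rewrite ge0_integralZl_EFin ?powR_ge0//; last 2 first.
- by move=> r _; rewrite lee_fin; have /andP[] := phi2 r.
- by apply/measurable_EFinP; exact: measurable_funTS.
rewrite lp1 (_ : c * (l * l `^ (p - 1)) = l `^ (p - 1) * (c / L)); last by rewrite -/l; ring.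
rewrite EFinM lee_wpmul2l ?lee_fin ?powR_ge0//; apply: le_trans phic.
apply: ge0_subset_integral => //.
- by apply/measurable_EFinP; exact: measurable_funTS.
- by move=> r _; rewrite lee_fin; have /andP[] := phi2 r.
by move=> r /=; rewrite !in_itv /= !andbT => /(lt_trans l0)/ltW.
Qed.
End powR_integral.

(** * Application to isotropic bodies *)

Section isotropic_body.
Context {R : realType} {n : nat} (K : set 'rV[R]_n) (L : R) (theta : 'rV[R]_n).
Hypothesis isoK : isotropic K L.
Hypothesis theta1 : unit_sphere theta.
Local Notation mu := (lebesgue_rV R n).
Local Notation X := (fun x : 'rV[R]_n => dotrV x theta).

Let cK : compact K. Proof. by case: isoK => -[]. Qed.
Let mK : measurable K. Proof. exact: compact_measurable_rV. Qed.
Let K1 : mu K = 1%E. Proof. by case: isoK. Qed.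
Let L0 : 0 < L. Proof. by case: isoK. Qed.
Let bK := compact_rV_bounded cK.

Let P := marginal_probability theta mK K1.

Let volK : vol K = 1. Proof. by rewrite /vol K1. Qed.

Let bounded_integrable (g : 'rV[R]_n -> R) (c : R) : measurable_fun setT g ->
  (forall x, K x -> `|g x| <= c) -> mu.-integrable K (EFin \o g).
Proof.
move=> mg gc; apply: measurable_bounded_integrable => //.
- by rewrite [ltLHS]K1 ltry.
- exact: measurable_funTS.
exists c; split; first exact: num_real.
by move=> e ce x Kx; apply: le_trans (gc x Kx) (ltW ce).
Qed.

Let coordinate_integral i :
  mu.-integrable K (EFin \o (fun x => x ord0 i)) /\ \int[mu]_(x in K) x ord0 i = 0.
Proof.
have [M KM] := bK; split.
  apply: (@bounded_integrable _ M); first exact: measurable_rV_coord.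
  by move=> x /(KM x i); rewrite /= in_itv /= ler_norml.
case: isoK => _ /rowP/(_ i); rewrite !mxE volK invr1 mul1r => + _ _ _.
exact.
Qed.

Let dotrV_integral_eq0 : \int[mu]_(x in K) X x = 0.
Proof.
(* Partial sums over lists let integrability and vanishing mean be carried together through the
   induction. *)
pose S (s : seq 'I_n) := fun x : 'rV[R]_n => \sum_(i <- s) x ord0 i * theta ord0 i.
suff : forall s, mu.-integrable K (EFin \o S s) /\ \int[mu]_(x in K) S s x = 0.
  by move=> /(_ (index_enum 'I_n))[].
elim=> [|i s [iS IH]].
  have -> : S [::] = cst 0 by apply/funext => x; rewrite /S big_nil.
  split; last by rewrite Rintegral_cst// mul0r.
  by apply: (@bounded_integrable _ 0) => // x _; rewrite normr0.
have e : S (i :: s) = (fun x => x ord0 i * theta ord0 i + S s x).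
  by apply/funext => x; rewrite /S big_cons.
rewrite e; have [ii i0] := coordinate_integral i.
have iti : mu.-integrable K (EFin \o (fun x => x ord0 i * theta ord0 i)).
  exact: (integrableZr mK (theta ord0 i) ii).
split; first exact: (integrableD mK iti iS).
by rewrite RintegralD// IH RintegralZr// i0 mul0r addr0.
Qed.

Let second_moment : \int[mu]_(x in K) X x ^+ 2 = L ^+ 2.
Proof. by case: isoK => _ _ _ _; apply. Qed.

Let small : forall a d : R, 0 < d -> fine (P `[a, a + d[%classic) <= 2 * d / L.
Proof.
have [M M0 KM] := marginal_bounded theta bK.
have mI : measurable (`[- M, M]%classic : set R) by exact: measurable_itv.
have xM (x : R) : `[- M, M]%classic x -> `|x| <= M by rewrite /= in_itv /= ler_norml.
apply: (@small_ball R P M L) => //.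
- rewrite /P /marginal_probability /= marginalE -K1; congr (mu _).
  by apply/seteqP; split => x /=; [case|move=> Kx; split => //; exact: KM].
- rewrite [LHS](@integral_marginal _ _ _ theta mK K1 id)//.
  exists M; split; first exact: num_real.
  by move=> c Mc x /xM h; apply: le_trans h (ltW Mc).
- rewrite [LHS](@integral_marginal _ _ _ theta mK K1 (fun x => x ^+ 2))//.
  exists (M ^+ 2); split; first exact: num_real.
  move=> c Mc x /xM h; apply: le_trans (ltW Mc).
  by rewrite normrX lerXn2r ?nnegrE// ltW.
- apply: (marginal_log_concave theta mK K1 bK).
  by apply: convex_rV_midpoint; case: isoK => -[].
Qed.

Let bounded_trig (g : R -> R) (r : R) : measurable_fun setT g -> (forall x, `|g x| <= 1) ->
  \int[P]_x g (r * x) = \int[mu]_(x in K) g (r * X x).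
Proof.
move=> mg g1; rewrite (@integral_marginal _ _ _ theta mK K1 (fun x => g (r * x)) setT)//.
  by apply: measurableT_comp => //; exact: measurable_funM.
exists 1; split; first exact: num_real.
by move=> c c1 x _; apply: le_trans (g1 _) (ltW c1).
Qed.

Let msin : measurable_fun setT (sin : R -> R).
Proof. by apply: continuous_measurable_fun; exact: continuous_sin. Qed.

Let mcos : measurable_fun setT (cos : R -> R).
Proof. by apply: continuous_measurable_fun; exact: continuous_cos. Qed.

Let cos1 (x : R) : `|cos x| <= 1.
Proof. by rewrite ler_norml cos_geN1 cos_le1. Qed.

Let sin1 (x : R) : `|sin x| <= 1.
Proof. by rewrite ler_norml sin_geN1 sin_le1. Qed.

Lemma fourier_transform_char_fun (r : R) :
  Normc.normc (fourier_transform (char_fun K) (r *: theta)) ^+ 2 = charfun_sqr P r.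
Proof.
have dE x : dotrV x (r *: theta) = r * X x by rewrite -[x in LHS]scale1r dotrVZ mul1r.
have restrict (g : 'rV[R]_n -> R) : \int[mu]_x (g x * \1_K x) = \int[mu]_(x in K) g x.
  rewrite [RHS]Rintegral_mkcond; apply: eq_Rintegral => x _.
  by rewrite /patch indicE; case: (x \in K); rewrite ?mulr1 ?mulr0.
rewrite /fourier_transform /= sqr_sqrtr; last by rewrite addr_ge0 ?sqr_ge0.
rewrite /charfun_sqr (bounded_trig _ mcos)// (bounded_trig _ msin)//.
congr (_ ^+ 2 + _).
  rewrite -restrict; apply: eq_Rintegral => x _.
  by rewrite /char_fun /expi /= dE mulr0 subr0 cosN.
(* The transform uses exp(-i<x, y>), so its imaginary part is minus the sine average; squaring hides
   the sign. *)
rewrite -[RHS]sqrrN; congr (_ ^+ 2).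
have ms : mu.-integrable K (EFin \o (fun x => sin (r * X x))).
  apply: (@bounded_integrable _ 1) => //; apply: measurableT_comp => //.
  by apply: measurable_funM => //; exact: measurable_dotrV.
rewrite -[RHS]mulN1r -RintegralZl// -restrict; apply: eq_Rintegral => x _.
by rewrite /char_fun /expi /= dE mulr0 add0r sinN mulN1r.
Qed.

Let charfun_sqr_ge (r : R) : 0 <= r <= L^-1 -> 4^-1 <= charfun_sqr P r.
Proof.
move=> /andP[r0 rL].
have rL2 : r ^+ 2 * L ^+ 2 <= 1.
  rewrite -exprMn expr_le1 ?mulr_ge0 ?(ltW L0)//.
  by rewrite -ler_pdivlMr// mul1r.
have [M M0 KM] := marginal_bounded theta bK.
have XM x : K x -> `|X x| <= M by move=> /KM; rewrite /= in_itv /= ler_norml.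
have i2 : mu.-integrable K (EFin \o (fun x => X x ^+ 2)).
  apply: (@bounded_integrable _ (M ^+ 2)).
    by apply: measurable_funX; exact: measurable_dotrV.
  by move=> x /XM h; rewrite normrX lerXn2r ?nnegrE// ltW.
have i2r : mu.-integrable K (EFin \o (fun x => (- (r ^+ 2 / 2)) * X x ^+ 2)).
  exact: (integrableZl mK _ i2).
have i1 : mu.-integrable K (EFin \o (fun x : 'rV[R]_n => 1)).
  by apply: (@bounded_integrable _ 1) => // x _; rewrite normr1.
have h : 2^-1 <= \int[P]_x cos (r * x).
  rewrite (bounded_trig _ mcos)//.
  apply: (@le_trans _ _ (\int[mu]_(x in K) (1 + (- (r ^+ 2 / 2)) * X x ^+ 2))).
    rewrite RintegralD// RintegralZl// second_moment Rintegral_cst// -[fine _]/(vol K) volK; lra.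
  apply: le_Rintegral => //.
  - exact: (integrableD mK i1 i2r).
  - apply: (@bounded_integrable _ 1) => //; apply: measurableT_comp => //.
    by apply: measurable_funM => //; exact: measurable_dotrV.
  move=> x _; have := cos_ge_sqr (r * X x); rewrite exprMn; lra.
rewrite /charfun_sqr; apply: (@le_trans _ _ ((\int[P]_x cos (r * x)) ^+ 2)).
  have -> : 4^-1 = 2^-1 ^+ 2 :> R by rewrite expr2; lra.
  by rewrite lerXn2r ?nnegrE// (le_trans _ h).
by rewrite lerDl sqr_ge0.
Qed.

(** The non-strict bounds with 8^-1 and 208 + 2 become strict at 9^-1 and 211 because the p-th power
    of [L^-1] is positive, and the root of order p preserves strictness. *)
Lemma fourier_mean_radius_bounds (p : R) : 0 < p <= 1 ->
  ((9^-1 `^ (1 / p) * L^-1)%:E < fourier_mean_radius p K theta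
     < (211 `^ (1 / p) * L^-1)%:E)%E.
Proof.
move=> /andP[p0 p1]; rewrite /fourier_mean_radius volK divr1.
under eq_integral do rewrite fourier_transform_char_fun.
have := @mellin_bounds R p p0 (charfun_sqr P) L 208 p1 L0 (measurable_charfun_sqr P).
have phi2 s : 0 <= charfun_sqr P s <= 2 by rewrite charfun_sqr_ge0 charfun_sqr_le2.
move=> /(_ phi2 charfun_sqr_ge (charfun_sqr_integral_le L0 small)).
set Q := (_ * _)%E => /andP[lQ Qu].
have Qfin : Q \is a fin_num.
  rewrite ge0_fin_numE; first by apply: le_lt_trans Qu _; rewrite ltry.
  by apply: le_trans lQ; rewrite lee_fin mulr_ge0// powR_ge0.
move: lQ Qu; rewrite -(fineK Qfin) poweR_EFin !lee_fin !lte_fin; move: (fine Q) => q lq qu.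
have Lp : 0 < L^-1 `^ p by rewrite powR_gt0// invr_gt0.
have E (c : R) : 0 <= c -> c `^ (1 / p) * L^-1 = (c * L^-1 `^ p) `^ p^-1.
  move=> c0; rewrite powRM ?powR_ge0// -powRrM mulfV ?gt_eqF// powRr1 ?invr_ge0 ?(ltW L0)//.
  by rewrite mul1r.
have mono (a b : R) : 0 <= a -> a < b -> a `^ p^-1 < b `^ p^-1.
  move=> a0 ab; apply: gt0_ltr_powR => //; first by rewrite invr_gt0.
  by rewrite nnegrE (le_trans a0)// ltW.
rewrite !E//; move: {E} (L^-1 `^ p) Lp lq qu => m m0 lq qu.
by apply/andP; split; apply: mono; lra.
Qed.
End isotropic_body.

Theorem theorem9 (R : realType) :
  exists c1 c2 c3 : R, [/\ 0 < c1, 0 < c2, 0 < c3 &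
    forall (n : nat) (K : set 'rV[R]_n) (L_K : R), isotropic K L_K ->
    forall p : R, 0 < p <= 1 ->
    forall theta : 'rV[R]_n, unit_sphere theta ->
      ((c3 * c1 `^ (1 / p) * L_K^-1)%R%:E
         < radial_function (fourier_mean_body p K) theta
         < (c3 * c2 `^ (1 / p) * L_K^-1)%R%:E)%E].
Proof.
exists 9^-1, 211, 1; split; [by rewrite invr_gt0 ltr0n|by rewrite ltr0n|exact: ltr01|].
move=> n K L isoK p p01 theta theta1; rewrite radial_fourier_mean_body//.
rewrite (mul1r (_ `^ _)) (mul1r (211 `^ _)).
by have := fourier_mean_radius_bounds isoK theta1 p01.
Qed.
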